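(* Let $A$ be a finite dimensional hereditary algebra over an algebraically closed field $k$, let $\mathcal{D}=\mathcal{D}^b(A)$ be the bounded derived category of finitely generated $A$-modules, and let $m\geq 1$. Let $T$ be a basic silting object of $\mathcal{D}$ lying in $\mathcal{S}_m$, and let $\Gamma=\mathrm{End}_{\mathcal{D}}T$. Let $\mathscr{T}=\mathrm{add}\,T$ and $\mathcal{W}=\mathscr{T}\ast\mathscr{T}[1]$. Then the functor $$G=\mathrm{Hom}_{\mathcal{D}}(T,-):\mathcal{W}\rightarrow \mathrm{mod}\,\Gamma$$ is full and dense, and $G$ also induces an equivalence of categories $$\overline{G}:\mathcal{W}/\mathrm{add}(T[1])\rightarrow \mathrm{mod}\,\Gamma.$$
   Context: $[1]$ denotes the shift functor of $\mathcal{D}$, and $\mathrm{Ext}^i(X,Y)=\mathrm{Hom}_{\mathcal{D}}(X,Y[i])$. A basic object $T$ of $\mathcal{D}$ (no repeated indecomposable summands up to isomorphism) is partial silting if $\mathrm{Ext}^i(T,T)=0$ for all $i>0$, and silting if in addition it is maximal with this property. $\mathcal{S}_m=\mathrm{mod}\,A[0]\vee \mathrm{mod}\,A[1]\vee\cdots\vee\mathrm{mod}\,A[m-1]\vee A[m]$ is the full subcategory of $\mathcal{D}$ whose objects are the finite direct sums of objects $N[i]$ with $N$ a finitely generated $A$-module and $0\leq i\leq m-1$, together with objects $Q[m]$ with $Q$ a finitely generated projective $A$-module. $\mathrm{add}\,T$ is the full subcategory of direct summands of finite direct sums of copies of $T$. For subcategories $\mathcal{X},\mathcal{Y}$ of $\mathcal{D}$,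 $\mathcal{X}\ast\mathcal{Y}$ is the full subcategory of objects $M$ for which there is a triangle $X\to M\to Y\to X[1]$ with $X\in\mathcal{X}$, $Y\in\mathcal{Y}$; $\mathscr{T}[1]=\{X[1]: X\in\mathscr{T}\}$. $\mathcal{W}/\mathrm{add}(T[1])$ is the quotient of $\mathcal{W}$ by the ideal of morphisms factoring through objects of $\mathrm{add}(T[1])$. $\mathrm{mod}\,\Gamma$ is the category of finitely generated $\Gamma$-modules, where $\mathrm{Hom}_{\mathcal{D}}(T,X)$ is a $\Gamma$-module via precomposition (left modules, with morphisms in $\Gamma$ multiplied in the order ''first $f$, then $g$''). Dense means essentially surjective. *)

(* Defs.v *)
From HB Require Import structures.
From mathcomp Require Import all_boot all_order all_algebra all_field.
From mathcomp Require Import boolp zify.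

Set Implicit Arguments.
Unset Strict Implicit.
Unset Printing Implicit Defensive.

Import Order.TTheory GRing.Theory Num.Theory.
Local Open Scope ring_scope.
Local Open Scope quotient_scope.

Section Quotient.
Variables (T : Type) (R : T -> T -> Prop).
Hypothesis Rrefl : forall x, R x x.
Hypothesis Rsym : forall x y, R x y -> R y x.
Hypothesis Rtrans : forall x y z, R x y -> R y z -> R x z.

Definition quo_rel : rel {classic T} := fun x y => `[< R x y >].

Lemma quo_rel_refl : reflexive quo_rel.
Proof. by move=> x; apply/asboolP/Rrefl. Qed.

Lemma quo_rel_sym : symmetric quo_rel.
Proof. by move=> x y; apply/asboolP/asboolP => /Rsym. Qed.

Lemma quo_rel_trans : transitive quo_rel.
Proof.
by move=> y x z /asboolP xy /asboolP yz; apply/asboolP/(Rtrans xy yz).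
Qed.

Definition quo_equiv : equiv_rel {classic T} :=
  EquivRel quo_rel quo_rel_refl quo_rel_sym quo_rel_trans.

Definition quo : Type := {eq_quot quo_equiv}.
HB.instance Definition _ := Choice.copy quo {eq_quot quo_equiv}.

Definition qclass (x : T) : quo := \pi_{eq_quot quo_equiv} (x : {classic T}).
Definition qrepr (q : quo) : T := repr (q : {eq_quot quo_equiv}).

Lemma qreprK q : qclass (qrepr q) = q.
Proof. exact: (@reprK _ {eq_quot quo_equiv}). Qed.

Lemma qclassP x y : qclass x = qclass y <-> R x y.
Proof.
split=> [|Rxy]; first by move/(@eqquotP _ quo_equiv _ _)/asboolP.
by apply/(@eqquotP _ quo_equiv _ _)/asboolP.
Qed.

Lemma qrepr_rel x : R (qrepr (qclass x)) x.
Proof. by apply/qclassP; rewrite qreprK. Qed.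

End Quotient.

Record category := Category {
  ob :> Type;
  hom : ob -> ob -> Type;
  idm : forall X, hom X X;
  comp : forall X Y Z, hom Y Z -> hom X Y -> hom X Z;
  comp_idl : forall X Y (f : hom X Y), comp (idm Y) f = f;
  comp_idr : forall X Y (f : hom X Y), comp f (idm X) = f;
  compA : forall X Y Z W (h : hom Z W) (g : hom Y Z) (f : hom X Y),
    comp h (comp g f) = comp (comp h g) f }.
Arguments idm {_} X.

Notation "g ∘ f" := (comp g f) (at level 40, left associativity).

Definition is_iso (C : category) (X Y : C) (f : hom X Y) : Prop :=
  exists g : hom Y X, g ∘ f = idm X /\ f ∘ g = idm Y.

Definition isomorphic (C : category) (X Y : C) : Prop :=
  exists f : hom X Y, is_iso f.

Record functor (C D : category) := Functor {
  fob :> C -> D;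
  fmap : forall X Y, hom X Y -> hom (fob X) (fob Y);
  fmap_id : forall X, fmap (idm X) = idm (fob X);
  fmap_comp : forall X Y Z (g : hom Y Z) (f : hom X Y),
    fmap (g ∘ f) = fmap g ∘ fmap f }.

Section Functors.
Variables C D E : category.

Definition id_functor : functor C C :=
  @Functor C C id (fun _ _ f => f) (fun _ => erefl) (fun _ _ _ _ _ => erefl).

Lemma comp_functor_id (G : functor D E) (F : functor C D) (X : C) :
  fmap G (fmap F (idm X)) = idm (G (F X)).
Proof. by rewrite !fmap_id. Qed.

Lemma comp_functor_comp (G : functor D E) (F : functor C D) (X Y Z : C)
    (g : hom Y Z) (f : hom X Y) :
  fmap G (fmap F (g ∘ f)) = fmap G (fmap F g) ∘ fmap G (fmap F f).
Proof. by rewrite !fmap_comp. Qed.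

Definition comp_functor (G : functor D E) (F : functor C D) : functor C E :=
  Functor (comp_functor_id G F) (comp_functor_comp G F).

Definition naturally_isomorphic (F G : functor C D) : Prop :=
  exists a : forall X : C, hom (F X) (G X),
    (forall X, is_iso (a X)) /\
    (forall X Y (f : hom X Y), a Y ∘ fmap F f = fmap G f ∘ a X).

Definition full (F : functor C D) : Prop :=
  forall X Y (g : hom (F X) (F Y)), exists f : hom X Y, fmap F f = g.

Definition dense (F : functor C D) : Prop :=
  forall Y : D, exists X : C, isomorphic (F X) Y.

End Functors.

Definition is_equivalence (C D : category) (F : functor C D) : Prop :=
  exists H : functor D C,
    naturally_isomorphic (comp_functor H F) (id_functor C) /\
    naturally_isomorphic (comp_functor F H) (id_functor D).

Definition full_subcat (C : category) (P : C -> Prop) : category :=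
  @Category {X : C | P X} (fun X Y => hom (sval X) (sval Y))
    (fun X => idm (sval X)) (fun _ _ _ g f => g ∘ f)
    (fun _ _ f => comp_idl f) (fun _ _ f => comp_idr f)
    (fun _ _ _ _ h g f => compA h g f).

Definition restrict_functor (C D : category) (F : functor C D)
    (P : C -> Prop) (P' : D -> Prop) (FP : forall X, P X -> P' (F X)) :
    functor (full_subcat P) (full_subcat P') :=
  @Functor (full_subcat P) (full_subcat P')
    (fun X => exist P' (F (sval X)) (FP (sval X) (svalP X)))
    (fun X Y f => fmap F f)
    (fun X => fmap_id F (sval X)) (fun X Y Z g f => fmap_comp F g f).

Record congruence (C : category) := Congruence {
  crel : forall X Y : C, hom X Y -> hom X Y -> Prop;
  crel_refl : forall X Y (f : hom X Y), crel f f;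
  crel_sym : forall X Y (f g : hom X Y), crel f g -> crel g f;
  crel_trans : forall X Y (f g h : hom X Y), crel f g -> crel g h -> crel f h;
  crel_comp : forall X Y Z (g g' : hom Y Z) (f f' : hom X Y),
    crel g g' -> crel f f' -> crel (g ∘ f) (g' ∘ f') }.
Arguments crel {C} c {X Y}.

Section QuotientCategory.
Variables (C : category) (R : congruence C).

Definition quot_hom (X Y : C) : Type :=
  quo (@crel_refl _ R X Y) (@crel_sym _ R X Y) (@crel_trans _ R X Y).

Definition quot_class (X Y : C) (f : hom X Y) : quot_hom X Y := qclass _ _ _ f.

Definition quot_idm (X : C) : quot_hom X X := quot_class (idm X).
Definition quot_comp (X Y Z : C) (g : quot_hom Y Z) (f : quot_hom X Y) :
  quot_hom X Z := quot_class (qrepr g ∘ qrepr f).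

Lemma quot_compE X Y Z (g : hom Y Z) (f : hom X Y) :
  quot_comp (quot_class g) (quot_class f) = quot_class (g ∘ f).
Proof. by apply/qclassP/crel_comp; apply: qrepr_rel. Qed.

Lemma quot_comp_idl X Y (f : quot_hom X Y) : quot_comp (quot_idm Y) f = f.
Proof. by rewrite -[f]qreprK [LHS]quot_compE comp_idl. Qed.

Lemma quot_comp_idr X Y (f : quot_hom X Y) : quot_comp f (quot_idm X) = f.
Proof. by rewrite -[f]qreprK [LHS]quot_compE comp_idr. Qed.

Lemma quot_compA X Y Z W (h : quot_hom Z W) (g : quot_hom Y Z)
    (f : quot_hom X Y) :
  quot_comp h (quot_comp g f) = quot_comp (quot_comp h g) f.
Proof.
rewrite -[f]qreprK -[g]qreprK -[h]qreprK.
by rewrite -!/(quot_class _) !quot_compE compA.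
Qed.

Definition quot_cat : category :=
  Category quot_comp_idl quot_comp_idr quot_compA.

Definition quot_functor : functor C quot_cat :=
  @Functor C quot_cat id quot_class (fun _ => erefl)
    (fun _ _ _ g f => esym (quot_compE g f)).

Variables (D : category) (F : functor C D).

Definition respects : Prop :=
  forall (X Y : C) (f g : hom X Y), crel R f g -> fmap F f = fmap F g.

Hypothesis FR : respects.

Lemma induced_id (X : C) :
  fmap F (qrepr (idm (X : quot_cat))) = idm (F X).
Proof. by rewrite (FR (qrepr_rel _ _ _ _)) fmap_id. Qed.

Lemma induced_comp (X Y Z : C) (g : quot_hom Y Z) (f : quot_hom X Y) :
  fmap F (qrepr (quot_comp g f)) = fmap F (qrepr g) ∘ fmap F (qrepr f).
Proof. by rewrite (FR (qrepr_rel _ _ _ _)) fmap_comp. Qed.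

Definition induced_functor : functor quot_cat D :=
  @Functor quot_cat D F (fun _ _ f => fmap F (qrepr f)) induced_id induced_comp.

Lemma induced_functorE X Y (f : hom X Y) :
  fmap induced_functor (fmap quot_functor f) = fmap F f.
Proof. exact: FR (qrepr_rel _ _ _ _). Qed.

End QuotientCategory.


Section ModuleCategory.
Variable R : pzRingType.

Definition finitely_generated (M : lmodType R) : Prop :=
  exists (n : nat) (e : 'I_n -> M),
    forall x : M, exists c : 'I_n -> R, x = \sum_(i < n) c i *: e i.

Lemma linear_ext (M N : lmodType R) (f g : {linear M -> N}) : f =1 g -> f = g.
Proof.
case: f => f [[af] [lf]]; case: g => g [[ag] [lg]] /funext /= efg; subst g.
by congr GRing.Linear.Pack; do 2?f_equal; f_equal; apply: Prop_irrelevance.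
Qed.

Definition Mod_idm (M : lmodType R) : {linear M -> M} := idfun.
Definition Mod_comp (M N P : lmodType R) (g : {linear N -> P})
  (f : {linear M -> N}) : {linear M -> P} := g \o f.

Lemma Mod_idl (M N : lmodType R) (f : {linear M -> N}) :
  Mod_comp (Mod_idm N) f = f.
Proof. exact: linear_ext. Qed.

Lemma Mod_idr (M N : lmodType R) (f : {linear M -> N}) :
  Mod_comp f (Mod_idm M) = f.
Proof. exact: linear_ext. Qed.

Lemma Mod_compA (M N P Q : lmodType R) (h : {linear P -> Q})
    (g : {linear N -> P}) (f : {linear M -> N}) :
  Mod_comp h (Mod_comp g f) = Mod_comp (Mod_comp h g) f.
Proof. exact: linear_ext. Qed.

Definition Mod : category := Category Mod_idl Mod_idr Mod_compA.

Definition mod : category := full_subcat (C := Mod) finitely_generated.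

End ModuleCategory.

Section DerivedCategory.
Variables (k : closedFieldType) (A : falgType k).

(* A finitely generated left A-module, in coordinates: after the choice of a  *)
(* k-basis it is k^n, as column vectors, with a acting as the matrix act a.   *)
(* Every such module is isomorphic to one of this form, and working in        *)
(* coordinates keeps the hom-sets of the localisation Db below small.         *)
Record amod := AMod {
  adim : nat;
  act : A -> 'M[k]_adim;
  act_linear : linear act;
  act1 : act 1 = 1%:M;
  actM : forall a b, act (a * b) = act a *m act b }.

Definition alinear (M N : amod) (F : 'M[k]_(adim N, adim M)) : Prop :=
  forall a, F *m act M a = act N a *m F.

Definition asurjective (M N : amod) (F : 'M[k]_(adim N, adim M)) : Prop :=
  forall y : 'cV[k]_(adim N), exists x : 'cV[k]_(adim M), F *m x = y.

Definition ainjective (M N : amod) (F : 'M[k]_(adim N, adim M)) : Prop :=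
  injective (fun x : 'cV[k]_(adim M) => F *m x).

Definition projective (P : amod) : Prop :=
  forall (M N : amod) (G : 'M[k]_(adim N, adim M)) (F : 'M[k]_(adim N, adim P)),
    alinear G -> asurjective G -> alinear F ->
    exists H : 'M[k]_(adim M, adim P), alinear H /\ G *m H = F.

Definition hereditary : Prop :=
  forall (M P : amod) (F : 'M[k]_(adim P, adim M)),
    projective P -> alinear F -> ainjective F -> projective M.

Lemma azero_linear : linear (fun _ : A => 0 : 'M[k]_0).
Proof. by move=> c a b; rewrite scaler0 addr0. Qed.

Lemma azero1 : 0 = 1%:M :> 'M[k]_0.
Proof. by rewrite [RHS]flatmx0. Qed.

Lemma azeroM (a b : A) : 0 = (0 : 'M[k]_0) *m (0 : 'M[k]_0).
Proof. by rewrite mulmx0. Qed.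

Definition azero : amod := AMod azero_linear azero1 azeroM.

Section DirectSum.
Variables M N : amod.

Definition asum_act (a : A) : 'M[k]_(adim M + adim N) :=
  block_mx (act M a) 0 0 (act N a).

Lemma asum_linear : linear asum_act.
Proof.
move=> c a b; rewrite /asum_act !act_linear scale_block_mx !scaler0.
by rewrite add_block_mx !addr0.
Qed.

Lemma asum1 : asum_act 1 = 1%:M.
Proof. by rewrite /asum_act !act1 -scalar_mx_block. Qed.

Lemma asumM a b : asum_act (a * b) = asum_act a *m asum_act b.
Proof.
by rewrite /asum_act !actM mulmx_block !mulmx0 !mul0mx !addr0 !add0r.
Qed.

Definition asum : amod := AMod asum_linear asum1 asumM.

End DirectSum.

(* Bounded cochain complexes: cd i is the differential from degree i to       *)
(* degree i + 1.                                                              *)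
Record cplx := Cplx {
  cob : int -> amod;
  cd : forall i, 'M[k]_(adim (cob (i + 1)), adim (cob i));
  cd_linear : forall i, alinear (cd i);
  cd_square : forall i, cd (i + 1) *m cd i = 0;
  cbounded : exists n : nat, forall i, (n < `|i|)%N -> adim (cob i) = 0%N }.

Record cmap (X Y : cplx) := CMap {
  cm : forall i, 'M[k]_(adim (cob Y i), adim (cob X i));
  cm_linear : forall i, alinear (cm i);
  cm_comm : forall i, cm (i + 1) *m cd X i = cd Y i *m cm i }.

Lemma cmap_ext X Y (f g : cmap X Y) : (forall i, cm f i = cm g i) -> f = g.
Proof.
case: f g => f lf cf [g lg cg] /= fg.
have {fg} fg : f = g by apply: functional_extensionality_dep.
by subst g; congr CMap; apply: Prop_irrelevance.
Qed.

Section ChainMaps.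

Lemma cid_linear X i : alinear (1%:M : 'M[k]_(adim (cob X i))).
Proof. by move=> a; rewrite mul1mx mulmx1. Qed.
Lemma cid_comm (X : cplx) i : 1%:M *m cd X i = cd X i *m 1%:M.
Proof. by rewrite mul1mx mulmx1. Qed.
Definition cid X : cmap X X := CMap (@cid_linear X) (@cid_comm X).

Lemma ccomp_linear X Y Z (g : cmap Y Z) (f : cmap X Y) i :
  alinear (cm g i *m cm f i).
Proof. by move=> a; rewrite -mulmxA cm_linear mulmxA cm_linear mulmxA. Qed.
Lemma ccomp_comm X Y Z (g : cmap Y Z) (f : cmap X Y) i :
  cm g (i + 1) *m cm f (i + 1) *m cd X i = cd Z i *m (cm g i *m cm f i).
Proof. by rewrite -mulmxA cm_comm mulmxA cm_comm mulmxA. Qed.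
Definition ccomp X Y Z (g : cmap Y Z) (f : cmap X Y) : cmap X Z :=
  CMap (ccomp_linear g f) (ccomp_comm g f).

Lemma cadd_linear X Y (f g : cmap X Y) i : alinear (cm f i + cm g i).
Proof. by move=> a; rewrite mulmxDl mulmxDr !cm_linear. Qed.
Lemma cadd_comm X Y (f g : cmap X Y) i :
  (cm f (i + 1) + cm g (i + 1)) *m cd X i = cd Y i *m (cm f i + cm g i).
Proof. by rewrite mulmxDl mulmxDr !cm_comm. Qed.
Definition cadd X Y (f g : cmap X Y) : cmap X Y :=
  CMap (cadd_linear f g) (cadd_comm f g).

End ChainMaps.

(* The map induced on cohomology in degree i + 1 is injective and surjective, *)
(* for every integer i.                                                       *)
Definition quasi_iso X Y (f : cmap X Y) : Prop :=
  (forall i (x : 'cV[k]_(adim (cob X (i + 1)))) (y : 'cV[k]_(adim (cob Y i))),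
     cd X (i + 1) *m x = 0 -> cm f (i + 1) *m x = cd Y i *m y ->
     exists x' : 'cV[k]_(adim (cob X i)), x = cd X i *m x') /\
  (forall i (y : 'cV[k]_(adim (cob Y (i + 1)))),
     cd Y (i + 1) *m y = 0 ->
     exists (x : 'cV[k]_(adim (cob X (i + 1)))) (y' : 'cV[k]_(adim (cob Y i))),
       cd X (i + 1) *m x = 0 /\ y = cm f (i + 1) *m x + cd Y i *m y').

Section Shift.
Variable X : cplx.

Lemma shift_linear i : @alinear (cob X (i + 1)) (cob X (i + 1 + 1))
  (- cd X (i + 1)).
Proof. by move=> a; rewrite mulNmx mulmxN cd_linear. Qed.
Lemma shift_square i : (- cd X (i + 1 + 1)) *m (- cd X (i + 1)) = 0.
Proof. by rewrite mulNmx mulmxN opprK cd_square. Qed.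
Lemma shift_bounded :
  exists n : nat, forall i, (n < `|i|)%N -> adim (cob X (i + 1)) = 0%N.
Proof.
have [n bX] := cbounded X; exists n.+1 => i ni; apply: bX.
by move: ni; lia.
Qed.
Definition shift : cplx := Cplx shift_linear shift_square shift_bounded.

End Shift.

Section ShiftMap.
Variables (X Y : cplx) (f : cmap X Y).

Lemma shift_cm_comm i :
  cm f (i + 1 + 1) *m (- cd X (i + 1)) = - cd Y (i + 1) *m cm f (i + 1).
Proof. by rewrite mulmxN mulNmx cm_comm. Qed.
Definition cshift : cmap (shift X) (shift Y) :=
  @CMap (shift X) (shift Y) _ (fun i => cm_linear f (i + 1)) shift_cm_comm.

Lemma cshift_quasi_iso : quasi_iso f -> quasi_iso cshift.
Proof.
have N0 m n (M : 'M[k]_(m, n)) (x : 'cV_n) : - M *m x = 0 -> M *m x = 0.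
  by move/eqP; rewrite mulNmx oppr_eq0 => /eqP.
have NN m n (M : 'M[k]_(m, n)) (x : 'cV_n) : - M *m x = M *m (- x).
  by rewrite mulNmx mulmxN.
case=> inj surj; split=> i /= => [x y /N0 dx|y /N0 dy].
  by rewrite NN => /(inj _ _ _ dx)[x' ->]; exists (- x');
    rewrite mulNmx mulmxN opprK.
have [x [y' [dx ->]]] := surj _ _ dy; exists x, (- y').
by rewrite !mulNmx mulmxN opprK dx oppr0.
Qed.

End ShiftMap.

Section Stalk.
Variable N : amod.

Definition stalk_ob (i : int) : amod := if i == 0 then N else azero.

Lemma stalk_linear i :
  @alinear (stalk_ob i) (stalk_ob (i + 1)) 0.
Proof. by move=> a; rewrite mul0mx mulmx0. Qed.
Lemma stalk_square i :
  (0 : 'M[k]_(adim (stalk_ob (i + 1 + 1)), adim (stalk_ob (i + 1)))) *m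
  (0 : 'M[k]_(adim (stalk_ob (i + 1)), adim (stalk_ob i))) = 0.
Proof. by rewrite mulmx0. Qed.
Lemma stalk_bounded :
  exists n : nat, forall i, (n < `|i|)%N -> adim (stalk_ob i) = 0%N.
Proof. by exists 0%N => i; rewrite /stalk_ob; case: eqP => // ->. Qed.

Definition stalk : cplx := Cplx stalk_linear stalk_square stalk_bounded.

End Stalk.

Definition czero : cplx := stalk azero.

Section ComplexSum.
Variables X Y : cplx.

Lemma dsum_linear i :
  @alinear (asum (cob X i) (cob Y i)) (asum (cob X (i + 1)) (cob Y (i + 1)))
    (block_mx (cd X i) 0 0 (cd Y i)).
Proof.
by move=> a; rewrite !mulmx_block !mulmx0 !mul0mx !addr0 !add0r !cd_linear.
Qed.
Lemma dsum_square i :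
  block_mx (cd X (i + 1)) 0 0 (cd Y (i + 1)) *m
    block_mx (cd X i) 0 0 (cd Y i) = 0.
Proof.
by rewrite mulmx_block !mulmx0 !mul0mx !addr0 !add0r !cd_square block_mx_const.
Qed.
Lemma dsum_bounded : exists n : nat, forall i, (n < `|i|)%N ->
  adim (asum (cob X i) (cob Y i)) = 0%N.
Proof.
have [m bX] := cbounded X; have [n bY] := cbounded Y.
by exists (maxn m n) => i; rewrite gtn_max => /andP[mi ni] /=; rewrite bX ?bY.
Qed.
Definition dsum : cplx := Cplx dsum_linear dsum_square dsum_bounded.

End ComplexSum.

Section SumMaps.
Variables X Y : cplx.

Lemma inl_linear i :
  @alinear (cob X i) (cob (dsum X Y) i) (col_mx 1%:M 0).
Proof.
move=> a; rewrite mul_col_mx mul_block_col !(mul1mx, mul0mx, mulmx0, mulmx1).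
by rewrite !addr0.
Qed.
Lemma inl_comm i : col_mx 1%:M 0 *m cd X i = cd (dsum X Y) i *m col_mx 1%:M 0.
Proof.
rewrite mul_col_mx mul_block_col !(mul1mx, mul0mx, mulmx0, mulmx1).
by rewrite !addr0.
Qed.
Definition sum_inl : cmap X (dsum X Y) := CMap inl_linear inl_comm.

Lemma inr_linear i :
  @alinear (cob Y i) (cob (dsum X Y) i) (col_mx 0 1%:M).
Proof.
move=> a; rewrite mul_col_mx mul_block_col !(mul1mx, mul0mx, mulmx0, mulmx1).
by rewrite !add0r.
Qed.
Lemma inr_comm i : col_mx 0 1%:M *m cd Y i = cd (dsum X Y) i *m col_mx 0 1%:M.
Proof.
rewrite mul_col_mx mul_block_col !(mul1mx, mul0mx, mulmx0, mulmx1).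
by rewrite !add0r.
Qed.
Definition sum_inr : cmap Y (dsum X Y) := CMap inr_linear inr_comm.

Lemma fst_linear i :
  @alinear (cob (dsum X Y) i) (cob X i) (row_mx 1%:M 0).
Proof.
move=> a; rewrite mul_mx_row mul_row_block !(mul1mx, mul0mx, mulmx0, mulmx1).
by rewrite !addr0.
Qed.
Lemma fst_comm i : row_mx 1%:M 0 *m cd (dsum X Y) i = cd X i *m row_mx 1%:M 0.
Proof.
rewrite mul_mx_row mul_row_block !(mul1mx, mul0mx, mulmx0, mulmx1).
by rewrite !addr0.
Qed.
Definition sum_fst : cmap (dsum X Y) X := CMap fst_linear fst_comm.

Lemma snd_linear i :
  @alinear (cob (dsum X Y) i) (cob Y i) (row_mx 0 1%:M).
Proof.
move=> a; rewrite mul_mx_row mul_row_block !(mul1mx, mul0mx, mulmx0, mulmx1).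
by rewrite !add0r.
Qed.
Lemma snd_comm i : row_mx 0 1%:M *m cd (dsum X Y) i = cd Y i *m row_mx 0 1%:M.
Proof.
rewrite mul_mx_row mul_row_block !(mul1mx, mul0mx, mulmx0, mulmx1).
by rewrite !add0r.
Qed.
Definition sum_snd : cmap (dsum X Y) Y := CMap snd_linear snd_comm.

End SumMaps.

(* The mapping cone, with cone^i = X^(i+1) (+) Y^i and differential           *)
(* (x, y) |-> (- d x, f x + d y).                                             *)
Section Cone.
Variables (X Y : cplx) (f : cmap X Y).

Definition cone_ob (i : int) : amod := asum (cob X (i + 1)) (cob Y i).
Definition cone_d (i : int) : 'M[k]_(adim (cone_ob (i + 1)), adim (cone_ob i)) :=
  block_mx (- cd X (i + 1)) 0 (cm f (i + 1)) (cd Y i).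

Lemma cone_linear i : alinear (cone_d i).
Proof.
move=> a; rewrite !mulmx_block !mulmx0 !mul0mx !addr0 !add0r.
by rewrite mulNmx mulmxN !cd_linear cm_linear.
Qed.
Lemma cone_square i : cone_d (i + 1) *m cone_d i = 0.
Proof.
rewrite mulmx_block !mulmx0 !mul0mx !addr0 !add0r mulmxN mulNmx !cd_square.
by rewrite mulmxN cm_comm addNr oppr0 oppr0 block_mx_const.
Qed.
Lemma cone_bounded :
  exists n : nat, forall i, (n < `|i|)%N -> adim (cone_ob i) = 0%N.
Proof.
have [m bX] := shift_bounded X; have [n bY] := cbounded Y.
by exists (maxn m n) => i; rewrite gtn_max => /andP[mi ni] /=; rewrite bX ?bY.
Qed.
Definition cone : cplx := Cplx cone_linear cone_square cone_bounded.

Lemma cone_in_linear i : @alinear (cob Y i) (cob cone i) (col_mx 0 1%:M).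
Proof.
move=> a; rewrite mul_col_mx mul_block_col !(mul1mx, mul0mx, mulmx0, mulmx1).
by rewrite !add0r.
Qed.
Lemma cone_in_comm i : col_mx 0 1%:M *m cd Y i = cd cone i *m col_mx 0 1%:M.
Proof.
rewrite mul_col_mx mul_block_col !(mul1mx, mul0mx, mulmx0, mulmx1).
by rewrite !add0r.
Qed.
Definition cone_in : cmap Y cone := CMap cone_in_linear cone_in_comm.

Lemma cone_out_linear i :
  @alinear (cob cone i) (cob (shift X) i) (row_mx 1%:M 0).
Proof.
move=> a; rewrite mul_mx_row mul_row_block !(mul1mx, mul0mx, mulmx0, mulmx1).
by rewrite !addr0.
Qed.
Lemma cone_out_comm i :
  row_mx 1%:M 0 *m cd cone i = cd (shift X) i *m row_mx 1%:M 0.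
Proof.
rewrite mul_mx_row mul_row_block !(mul1mx, mul0mx, mulmx0, mulmx1).
by rewrite !addr0.
Qed.
Definition cone_out : cmap cone (shift X) :=
  CMap cone_out_linear cone_out_comm.

End Cone.

(* D^b(A) is the localisation of the category of bounded complexes at the     *)
(* quasi-isomorphisms, presented by generators (chain maps and formal         *)
(* inverses of quasi-isomorphisms) and relations.  Quasi-isomorphisms are     *)
(* closed under direct sums, so that the localisation is preadditive and the  *)
(* localisation functor additive; hence imposing the preadditive structure in *)
(* the presentation does not change the result.                               *)
Inductive word : cplx -> cplx -> Type :=
| wmap X Y of cmap X Y : word X Y
| winv X Y (s : cmap X Y) of quasi_iso s : word Y X
| wcomp X Y Z of word Y Z & word X Y : word X Z
| wzero X Y : word X Y
| wopp X Y of word X Y : word X Y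
| wadd X Y of word X Y & word X Y : word X Y.

Inductive weq : forall X Y, word X Y -> word X Y -> Prop :=
| weq_refl X Y (u : word X Y) : weq u u
| weq_sym X Y (u v : word X Y) : weq u v -> weq v u
| weq_trans X Y (u v w : word X Y) : weq u v -> weq v w -> weq u w
| weq_comp X Y Z (v v' : word Y Z) (u u' : word X Y) :
    weq v v' -> weq u u' -> weq (wcomp v u) (wcomp v' u')
| weq_opp X Y (u u' : word X Y) : weq u u' -> weq (wopp u) (wopp u')
| weq_add X Y (u u' v v' : word X Y) :
    weq u u' -> weq v v' -> weq (wadd u v) (wadd u' v')
| weq_compA X Y Z W (w : word Z W) (v : word Y Z) (u : word X Y) :
    weq (wcomp w (wcomp v u)) (wcomp (wcomp w v) u)
| weq_idl X Y (u : word X Y) : weq (wcomp (wmap (cid Y)) u) u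
| weq_idr X Y (u : word X Y) : weq (wcomp u (wmap (cid X))) u
| weq_addA X Y (u v w : word X Y) :
    weq (wadd u (wadd v w)) (wadd (wadd u v) w)
| weq_addC X Y (u v : word X Y) : weq (wadd u v) (wadd v u)
| weq_add0 X Y (u : word X Y) : weq (wadd (wzero X Y) u) u
| weq_addN X Y (u : word X Y) : weq (wadd (wopp u) u) (wzero X Y)
| weq_compDl X Y Z (v v' : word Y Z) (u : word X Y) :
    weq (wcomp (wadd v v') u) (wadd (wcomp v u) (wcomp v' u))
| weq_compDr X Y Z (v : word Y Z) (u u' : word X Y) :
    weq (wcomp v (wadd u u')) (wadd (wcomp v u) (wcomp v u'))
| weq_map_comp X Y Z (g : cmap Y Z) (f : cmap X Y) :
    weq (wmap (ccomp g f)) (wcomp (wmap g) (wmap f))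
| weq_map_add X Y (f g : cmap X Y) :
    weq (wmap (cadd f g)) (wadd (wmap f) (wmap g))
| weq_invl X Y (s : cmap X Y) (hs : quasi_iso s) :
    weq (wcomp (winv hs) (wmap s)) (wmap (cid X))
| weq_invr X Y (s : cmap X Y) (hs : quasi_iso s) :
    weq (wcomp (wmap s) (winv hs)) (wmap (cid Y)).

Definition Hom (X Y : cplx) : Type :=
  quo (@weq_refl X Y) (@weq_sym X Y) (@weq_trans X Y).
HB.instance Definition _ (X Y : cplx) := Choice.on (Hom X Y).

Definition hclass (X Y : cplx) (u : word X Y) : Hom X Y := qclass _ _ _ u.

Lemma hclassP X Y (u v : word X Y) : hclass u = hclass v <-> weq u v.
Proof. exact: qclassP. Qed.

Lemma hclass_surj X Y (f : Hom X Y) : exists u, f = hclass u.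
Proof. by exists (qrepr f); rewrite -[LHS]qreprK. Qed.

Lemma hrepr_weq X Y (u : word X Y) : weq (qrepr (hclass u)) u.
Proof. exact: qrepr_rel. Qed.

Definition hzero X Y : Hom X Y := hclass (wzero X Y).
Definition hopp X Y (f : Hom X Y) : Hom X Y := hclass (wopp (qrepr f)).
Definition hadd X Y (f g : Hom X Y) : Hom X Y :=
  hclass (wadd (qrepr f) (qrepr g)).
Definition hid X : Hom X X := hclass (wmap (cid X)).
Definition hcomp X Y Z (g : Hom Y Z) (f : Hom X Y) : Hom X Z :=
  hclass (wcomp (qrepr g) (qrepr f)).

Lemma hoppE X Y (u : word X Y) : hopp (hclass u) = hclass (wopp u).
Proof. by apply/hclassP/weq_opp/hrepr_weq. Qed.
Lemma haddE X Y (u v : word X Y) :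
  hadd (hclass u) (hclass v) = hclass (wadd u v).
Proof. by apply/hclassP/weq_add; apply: hrepr_weq. Qed.
Lemma hcompE X Y Z (v : word Y Z) (u : word X Y) :
  hcomp (hclass v) (hclass u) = hclass (wcomp v u).
Proof. by apply/hclassP/weq_comp; apply: hrepr_weq. Qed.

Lemma haddA X Y : associative (@hadd X Y).
Proof.
move=> f g h; have [u ->] := hclass_surj f; have [v ->] := hclass_surj g.
have [w ->] := hclass_surj h; rewrite !haddE; exact/hclassP/weq_addA.
Qed.
Lemma haddC X Y : commutative (@hadd X Y).
Proof.
move=> f g; have [u ->] := hclass_surj f; have [v ->] := hclass_surj g.
rewrite !haddE; exact/hclassP/weq_addC.
Qed.
Lemma hadd0 X Y : left_id (hzero X Y) (@hadd X Y).
Proof.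
move=> f; have [u ->] := hclass_surj f; rewrite haddE.
exact/hclassP/weq_add0.
Qed.
Lemma haddN X Y : left_inverse (hzero X Y) (@hopp X Y) (@hadd X Y).
Proof.
move=> f; have [u ->] := hclass_surj f; rewrite hoppE haddE.
exact/hclassP/weq_addN.
Qed.

HB.instance Definition _ (X Y : cplx) := GRing.isZmodule.Build (Hom X Y)
  (@haddA X Y) (@haddC X Y) (@hadd0 X Y) (@haddN X Y).

Lemma hcomp_idl X Y (f : Hom X Y) : hcomp (hid Y) f = f.
Proof.
have [u ->] := hclass_surj f; rewrite hcompE; exact/hclassP/weq_idl.
Qed.
Lemma hcomp_idr X Y (f : Hom X Y) : hcomp f (hid X) = f.
Proof.
have [u ->] := hclass_surj f; rewrite hcompE; exact/hclassP/weq_idr.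
Qed.
Lemma hcompA X Y Z W (h : Hom Z W) (g : Hom Y Z) (f : Hom X Y) :
  hcomp h (hcomp g f) = hcomp (hcomp h g) f.
Proof.
have [u ->] := hclass_surj f; have [v ->] := hclass_surj g.
have [w ->] := hclass_surj h; rewrite !hcompE; exact/hclassP/weq_compA.
Qed.
Lemma hcompDl X Y Z (g g' : Hom Y Z) (f : Hom X Y) :
  hcomp (g + g') f = hcomp g f + hcomp g' f.
Proof.
have [u ->] := hclass_surj f; have [v ->] := hclass_surj g.
have [w ->] := hclass_surj g'.
rewrite -[_ + _]/(hadd _ _) -[RHS]/(hadd _ _) !(haddE, hcompE).
exact/hclassP/weq_compDl.
Qed.
Lemma hcompDr X Y Z (g : Hom Y Z) (f f' : Hom X Y) :
  hcomp g (f + f') = hcomp g f + hcomp g f'.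
Proof.
have [u ->] := hclass_surj f; have [v ->] := hclass_surj g.
have [w ->] := hclass_surj f'.
rewrite -[_ + _]/(hadd _ _) -[RHS]/(hadd _ _) !(haddE, hcompE).
exact/hclassP/weq_compDr.
Qed.
Lemma hcompBl X Y Z (g g' : Hom Y Z) (f : Hom X Y) :
  hcomp (g - g') f = hcomp g f - hcomp g' f.
Proof. by apply/eqP; rewrite eq_sym subr_eq -hcompDl subrK. Qed.
Lemma hcompBr X Y Z (g : Hom Y Z) (f f' : Hom X Y) :
  hcomp g (f - f') = hcomp g f - hcomp g f'.
Proof. by apply/eqP; rewrite eq_sym subr_eq -hcompDr subrK. Qed.

Definition Db : category := Category hcomp_idl hcomp_idr hcompA.

Definition Q (X Y : Db) (f : cmap X Y) : hom X Y := hclass (wmap f).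

Lemma Q_comp X Y Z (g : cmap Y Z) (f : cmap X Y) :
  Q (ccomp g f) = hcomp (Q g) (Q f).
Proof. by rewrite [RHS]hcompE; apply/hclassP/weq_map_comp. Qed.
Lemma Q_add X Y (f g : cmap X Y) : Q (cadd f g) = Q f + Q g.
Proof. by rewrite [RHS]haddE; apply/hclassP/weq_map_add. Qed.

Fixpoint wshift X Y (u : word X Y) : word (shift X) (shift Y) :=
  match u in word X Y return word (shift X) (shift Y) with
  | wmap _ _ f => wmap (cshift f)
  | winv _ _ s hs => winv (cshift_quasi_iso hs)
  | wcomp _ _ _ v u => wcomp (wshift v) (wshift u)
  | wzero _ _ => wzero _ _
  | wopp _ _ u => wopp (wshift u)
  | wadd _ _ u v => wadd (wshift u) (wshift v)
  end.

Lemma wshift_weq X Y (u v : word X Y) : weq u v -> weq (wshift u) (wshift v).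
Proof.
have cidE Z : cshift (cid Z) = cid (shift Z) by apply: cmap_ext.
have compE X' Y' Z (g : cmap Y' Z) (f : cmap X' Y') :
  cshift (ccomp g f) = ccomp (cshift g) (cshift f) by apply: cmap_ext.
have addE X' Y' (f g : cmap X' Y') :
  cshift (cadd f g) = cadd (cshift f) (cshift g) by apply: cmap_ext.
by elim=> /=; intros; rewrite ?(cidE, compE, addE); eauto using weq.
Qed.

Definition hshift (X Y : Db) (f : hom X Y) : hom (shift X : Db) (shift Y) :=
  hclass (wshift (qrepr f)).

Lemma hshiftE X Y (u : word X Y) : hshift (hclass u) = hclass (wshift u).
Proof. by apply/hclassP/wshift_weq/hrepr_weq. Qed.

(* The triangles isomorphic to X' -> Y' -> cone f -> X'[1] for a chain map f. *)
Definition distinguished (X Y Z : Db) (u : hom X Y) (v : hom Y Z)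
    (w : hom Z (shift X)) : Prop :=
  exists (X' Y' : Db) (f : cmap X' Y')
    (a : hom X' X) (b : hom Y' Y) (c : hom (cone f : Db) Z),
    [/\ is_iso a, is_iso b & is_iso c] /\
    [/\ b ∘ Q f = u ∘ a,
        c ∘ Q (cone_in f) = v ∘ b &
        hshift a ∘ Q (cone_out f) = w ∘ c].

Definition power (n : nat) (X : Db) : Db := iter n (dsum X) czero.

Definition add_closure (U X : Db) : Prop :=
  exists (n : nat) (Y : Db), isomorphic (dsum X Y : Db) (power n U).

Definition star (P P' : Db -> Prop) (M : Db) : Prop :=
  exists (X Y : Db) (u : hom X M) (v : hom M Y) (w : hom Y (shift X)),
    [/\ P X, P' Y & distinguished u v w].

Definition shift_class (P : Db -> Prop) (X : Db) : Prop :=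
  exists2 Z : Db, P Z & X = shift Z.

Definition in_W (T : Db) : Db -> Prop :=
  star (add_closure T) (shift_class (add_closure T)).

Definition W (T : Db) : category := full_subcat (in_W T).

Definition in_S (m : nat) (X : Db) : Prop :=
  exists (n : nat) (e : 'I_n -> Db),
    (forall j,
      (exists (N : amod) (i : nat), (i < m)%N /\ e j = iter i shift (stalk N)) \/
      (exists P : amod, projective P /\ e j = iter m shift (stalk P))) /\
    isomorphic X (\big[dsum/czero]_(j < n) e j).

Definition indecomposable (X : Db) : Prop :=
  ~ isomorphic X czero /\
  forall Y Z : Db, isomorphic X (dsum Y Z) ->
    isomorphic Y czero \/ isomorphic Z czero.

Definition basic (X : Db) : Prop :=
  forall Y Z : Db, indecomposable Y -> ~ isomorphic X (dsum (dsum Y Y) Z).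

Definition Ext (i : nat) (X Y : Db) : zmodType := Hom X (iter i shift Y).

Definition partial_silting (T : Db) : Prop :=
  basic T /\ forall i : nat, (0 < i)%N -> forall f : Ext i T T, f = 0.

(* Maximality is among basic objects, ordered by being a direct summand.      *)
Definition silting (T : Db) : Prop :=
  partial_silting T /\
  forall X : Db, partial_silting (dsum T X) -> isomorphic X czero.

Section FactorIdeal.
Variables (P : Db -> Prop) (U : Db).

Definition factors_through_add (X Y : Db) (f : Hom X Y) : Prop :=
  exists (V : Db) (u : hom X V) (v : hom V Y), add_closure U V /\ f = v ∘ u.

(* Equivalent to factors_through_add; used to prove that the latter is closed *)
(* under addition.                                                            *)
Inductive sum_through (X Y : Db) : Hom X Y -> Prop :=
| sum_through0 : sum_through 0
| sum_throughD (u : hom X U) (v : hom U Y) (f : Hom X Y) :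
    sum_through f -> sum_through (hcomp v u + f).

Lemma cmap_from0 (X : cplx) (f g : cmap czero X) : f = g.
Proof.
apply: cmap_ext => i; apply/matrixP => r [c lt_c]; exfalso; move: lt_c.
by rewrite /czero /= /stalk_ob; case: (i == 0).
Qed.

Lemma hcomp0l (X Y Z : Db) (f : Hom X Y) : hcomp (0 : Hom Y Z) f = 0.
Proof. by rewrite -(subrr 0) hcompBl subrr. Qed.

Lemma hcomp0r (X Y Z : Db) (f : Hom Y Z) : hcomp f (0 : Hom X Y) = 0.
Proof. by rewrite -(subrr 0) hcompBr subrr. Qed.

Lemma Q_from0 (X : Db) (f : cmap czero X) : Q f = 0 :> Hom _ _.
Proof.
have /(congr1 (@Q _ _)) := cmap_from0 (cadd f f) f.
by rewrite Q_add => /eqP; rewrite -subr_eq0 addrK => /eqP.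
Qed.

Lemma hid0 : hid czero = 0.
Proof. exact: Q_from0. Qed.

Section SumEquations.
Variables X Y : cplx.

Lemma sum_id : hcomp (Q (sum_inl X Y)) (Q (sum_fst X Y)) +
  hcomp (Q (sum_inr X Y)) (Q (sum_snd X Y)) = hid (dsum X Y).
Proof.
rewrite -!Q_comp -Q_add; congr (Q _); apply: cmap_ext => i /=.
rewrite !mul_col_row !(mul1mx, mul0mx, mulmx0) add_block_mx !addr0 !add0r.
by rewrite -scalar_mx_block.
Qed.

Lemma fst_inl : hcomp (Q (sum_fst X Y)) (Q (sum_inl X Y)) = hid X.
Proof.
rewrite -Q_comp; congr (Q _); apply: cmap_ext => i /=.
by rewrite mul_row_col mul1mx mul0mx addr0.
Qed.

Lemma snd_inr : hcomp (Q (sum_snd X Y)) (Q (sum_inr X Y)) = hid Y.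
Proof.
rewrite -Q_comp; congr (Q _); apply: cmap_ext => i /=.
by rewrite mul_row_col mul1mx mul0mx add0r.
Qed.

Lemma fst_inr : hcomp (Q (sum_fst X Y)) (Q (sum_inr X Y)) = 0.
Proof.
have H : ccomp (sum_fst X Y) (sum_inr X Y) =
    cadd (ccomp (sum_fst X Y) (sum_inr X Y)) (ccomp (sum_fst X Y) (sum_inr X Y)).
  by apply: cmap_ext => i /=; rewrite mul_row_col mul1mx mul0mx !addr0.
move/(congr1 (@Q _ _))/eqP: H; rewrite -Q_comp Q_add.
by rewrite eq_sym -subr_eq0 addrK => /eqP.
Qed.

Lemma snd_inl : hcomp (Q (sum_snd X Y)) (Q (sum_inl X Y)) = 0.
Proof.
have H : ccomp (sum_snd X Y) (sum_inl X Y) =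
    cadd (ccomp (sum_snd X Y) (sum_inl X Y)) (ccomp (sum_snd X Y) (sum_inl X Y)).
  by apply: cmap_ext => i /=; rewrite mul_row_col mul1mx mul0mx !addr0.
move/(congr1 (@Q _ _))/eqP: H; rewrite -Q_comp Q_add.
by rewrite eq_sym -subr_eq0 addrK => /eqP.
Qed.

End SumEquations.

Lemma add_closure_power n : add_closure U (power n U).
Proof.
exists n, czero, (Q (sum_fst _ _)), (Q (sum_inl _ _)); split; last first.
  exact: fst_inl.
by rewrite -[RHS]sum_id [Q (sum_inr _ _)]Q_from0 hcomp0l addr0.
Qed.

Lemma sum_through_add (X Y : Db) (f g : Hom X Y) :
  sum_through f -> sum_through g -> sum_through (f + g).
Proof.
by elim=> [|u v f' _ IH] sg; rewrite ?add0r // -addrA; constructor; apply: IH.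
Qed.

Lemma sum_through_comp (X X' Y Y' : Db) (f : Hom X Y) (g : Hom Y Y')
    (h : Hom X' X) :
  sum_through f -> sum_through (hcomp g (hcomp f h)).
Proof.
elim=> [|u v f' _ IH]; first by rewrite hcomp0l hcomp0r; constructor.
by rewrite hcompDl hcompDr -hcompA (hcompA g); constructor.
Qed.

Lemma sum_through_power n : sum_through (hid (power n U)).
Proof.
elim: n => [|n IH]; first by rewrite [hid _]hid0; constructor.
rewrite -[hid _](sum_id U (power n U)); constructor.
rewrite -[Q (sum_snd _ _)]hcomp_idl; exact: sum_through_comp.
Qed.

Lemma factors_sum_through (X Y : Db) (f : Hom X Y) :
  factors_through_add f <-> sum_through f.
Proof.
split=> [[V [u [v [[n [V' [a [b [ba _]]]]] ->]]]]|].
  have idV : hid V = hcomp (hcomp (Q (sum_fst V V')) b)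
      (hcomp (hid (power n U)) (hcomp a (Q (sum_inl V V')))).
    have ba' : hcomp b a = hid (dsum V V') := ba.
    by rewrite hcomp_idl -hcompA (hcompA b) ba' hcomp_idl fst_inl.
  rewrite -[u]hcomp_idl idV -![_ ∘ _]/(hcomp _ _) -!hcompA (hcompA v) (hcompA (hcomp v _)).
  exact/sum_through_comp/sum_through_power.
suff H : sum_through f ->
    exists n (u : Hom X (power n U)) (v : Hom (power n U) Y), f = hcomp v u.
  by move=> /H[n [u [v ->]]]; exists (power n U), u, v; split=> //;
    exact: add_closure_power.
elim=> [|u v f' _ [n [u' [v' ->]]]]; first by exists 0%N, 0, 0; rewrite hcomp0l.
exists n.+1, (hcomp (Q (sum_inl U (power n U))) u +
              hcomp (Q (sum_inr U (power n U))) u' : Hom X (power n.+1 U)),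
  (hcomp v (Q (sum_fst U (power n U))) +
   hcomp v' (Q (sum_snd U (power n U))) : Hom (power n.+1 U) Y).
rewrite hcompDl !hcompDr -!hcompA !(hcompA (Q _) (Q _)).
rewrite fst_inl snd_inr fst_inr snd_inl !hcomp0l !hcomp0r !hcomp_idl.
by rewrite addr0 add0r.
Qed.

Lemma factors0 (X Y : Db) : factors_through_add (0 : Hom X Y).
Proof. by apply/factors_sum_through; constructor. Qed.

Lemma factorsD (X Y : Db) (f g : Hom X Y) :
  factors_through_add f -> factors_through_add g -> factors_through_add (f + g).
Proof.
by rewrite !factors_sum_through; apply: sum_through_add.
Qed.

Lemma factors_comp (X X' Y Y' : Db) (f : Hom X Y) (g : Hom Y Y')
    (h : Hom X' X) :
  factors_through_add f -> factors_through_add (hcomp g (hcomp f h)).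
Proof. by rewrite !factors_sum_through; apply: sum_through_comp. Qed.

Lemma factorsN (X Y : Db) (f : Hom X Y) :
  factors_through_add f -> factors_through_add (- f).
Proof.
move/(factors_comp (- hid Y) (hid X)).
by rewrite hcomp_idr -[- hid Y]add0r hcompBl hcomp0l hcomp_idl sub0r.
Qed.

Definition factor_rel (X Y : full_subcat P) (f g : hom X Y) : Prop :=
  factors_through_add ((f : Hom _ _) - (g : Hom _ _)).

Lemma factor_refl (X Y : full_subcat P) (f : hom X Y) : factor_rel f f.
Proof. by rewrite /factor_rel subrr; apply: factors0. Qed.

Lemma factor_sym (X Y : full_subcat P) (f g : hom X Y) :
  factor_rel f g -> factor_rel g f.
Proof. by move/factorsN; rewrite opprB. Qed.

Lemma factor_trans (X Y : full_subcat P) (f g h : hom X Y) :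
  factor_rel f g -> factor_rel g h -> factor_rel f h.
Proof. by move=> /factorsD H /H; rewrite addrA subrK. Qed.

Lemma factor_comp (X Y Z : full_subcat P) (g g' : hom Y Z) (f f' : hom X Y) :
  factor_rel g g' -> factor_rel f f' -> factor_rel (g ∘ f) (g' ∘ f').
Proof.
move=> /(factors_comp (hid _) f) gg' /(factors_comp g' (hid _)) ff'.
move: (factorsD gg' ff'); rewrite hcomp_idl hcomp_idr hcompBl hcompBr.
by rewrite addrA subrK.
Qed.

Definition factor_congruence : congruence (full_subcat P) :=
  Congruence factor_refl factor_sym factor_trans factor_comp.

End FactorIdeal.

(* The endomorphism ring, with f * g equal to "first f, then g".              *)
Definition endo (T : Db) : Type := Hom T T.
HB.instance Definition _ (T : Db) := GRing.Zmodule.copy (endo T) (Hom T T).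

Section Endo.
Variable T : Db.

Definition endo_mul (f g : endo T) : endo T := hcomp g f.

Lemma endo_mulA : associative endo_mul.
Proof. by move=> f g h; rewrite /endo_mul hcompA. Qed.
Lemma endo_mul1 : left_id (hid T : endo T) endo_mul.
Proof. exact: hcomp_idr. Qed.
Lemma endo_1mul : right_id (hid T : endo T) endo_mul.
Proof. exact: hcomp_idl. Qed.
Lemma endo_mulDl : left_distributive endo_mul +%R.
Proof. by move=> f g h; apply: hcompDr. Qed.
Lemma endo_mulDr : right_distributive endo_mul +%R.
Proof. by move=> f g h; apply: hcompDl. Qed.

HB.instance Definition _ := GRing.Zmodule_isPzRing.Build (endo T)
  endo_mulA endo_mul1 endo_1mul endo_mulDl endo_mulDr.

Variable X : Db.

Definition endo_scale (a : endo T) (f : Hom T X) : Hom T X := hcomp f a.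

Lemma endo_scaleA a b f :
  endo_scale a (endo_scale b f) = endo_scale (a * b) f.
Proof. by rewrite /endo_scale -hcompA. Qed.
Lemma endo_scale1 : left_id 1 endo_scale.
Proof. exact: hcomp_idr. Qed.
Lemma endo_scaleDr : right_distributive endo_scale +%R.
Proof. by move=> a f g; apply: hcompDl. Qed.
Lemma endo_scaleDl f : {morph endo_scale^~ f : a b / a + b}.
Proof. by move=> a b; apply: hcompDr. Qed.

HB.instance Definition _ := GRing.Zmodule_isLmodule.Build (endo T) (Hom T X)
  endo_scaleA endo_scale1 endo_scaleDr endo_scaleDl.

End Endo.

Section HomFunctor.
Variable T : Db.

Section Postcomp.
Variables (X Y : Db) (f : hom X Y).

Definition postcomp (h : Hom T X) : Hom T Y := f ∘ h.

Lemma postcomp_linear : linear (postcomp : Hom T X -> Hom T Y).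
Proof.
move=> a g h; rewrite /postcomp -![_ ∘ _]/(hcomp _ _) hcompDr; congr (_ + _).
exact: hcompA.
Qed.

HB.instance Definition _ :=
  GRing.isLinear.Build (endo T) (Hom T X) (Hom T Y) *:%R postcomp
    postcomp_linear.

End Postcomp.

Definition hom_module (X : Db) : Mod (endo T) := Hom T X : lmodType (endo T).
Definition hom_map (X Y : Db) (f : hom X Y) :
  hom (hom_module X) (hom_module Y) := postcomp f : {linear Hom T X -> Hom T Y}.

Lemma hom_map_id X : hom_map (idm X) = idm (hom_module X).
Proof. by apply: linear_ext => h; apply: hcomp_idl. Qed.

Lemma hom_map_comp X Y Z (g : hom Y Z) (f : hom X Y) :
  hom_map (g ∘ f) = hom_map g ∘ hom_map f.
Proof. by apply: linear_ext => h; apply/esym/hcompA. Qed.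

Definition hom_functor : functor Db (Mod (endo T)) :=
  Functor hom_map_id hom_map_comp.

End HomFunctor.

End DerivedCategory.

(* Main.v *)
(* Only Ext^1(T, T) = 0 matters.  An object M of W has a presentation           *)
(* Z -> X -> M -> Z[1] with Z and X in add T, and Hom(T, Z[1]) = 0 makes        *)
(* Hom(T, X) -> Hom(T, M) surjective.  A linear map Hom(T, M) -> Hom(T, M')     *)
(* therefore comes from a morphism X -> M' killing Z, which factors through M;  *)
(* a morphism M -> M' inducing zero kills X, hence factors through Z[1].  Since *)
(* End(T) is finite dimensional, every finitely generated module has a          *)
(* presentation by powers of Hom(T, T), and the cone of the corresponding map   *)
(* T^p -> T^n is a preimage in W.                                               *)
(*                                                                              *)
(* Everything in D^b(A) is computed on bounded complexes of projectives P:      *)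
(* A being hereditary, every complex is quasi-isomorphic to one of them, and    *)
(* Hom(P, Y) in D^b(A) is the group of homotopy classes of chain maps P -> Y.   *)

From HB Require Import structures.
From mathcomp Require Import all_boot all_order all_algebra all_field.
From mathcomp Require Import boolp zify ring.
Require Import Defs.

Set Implicit Arguments.
Unset Strict Implicit.
Unset Printing Implicit Defensive.

Import Order.TTheory GRing.Theory Num.Theory.
Local Open Scope ring_scope.

(** Apply Hom(T, -) to the triangle X -> M -> Z[1] -> X[1] that puts M in [W], where X and Z lie in
    add T. Fullness, and faithfulness modulo add(T[1]), are diagram chases from three facts: Hom is
    exact on triangles, Hom(T, T[1]) = 0, and the identity of an object of add T is a finite sum of
    maps through T. They are carried out in [in_W_presentation], [presentation_surj], [in_W_full]
    and [in_W_faithful]. For density ([in_W_dense]), a presentation of N by powers of End(T) is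
    realised by a map T^p -> T^n, whose cone is the preimage ([presented_in_W]); [endo_noetherian]
    makes p finite.

    The rest makes the localisation computable. A chain map from a bounded complex of projectives P
    to an acyclic complex is nullhomotopic ([nullhomotopic_acyclic]), so quasi-isomorphisms act
    bijectively on homotopy classes of maps out of P. The words presenting [Db] therefore act on
    these classes ([ev]), compatibly with the relations ([ev_weq]). Applying a word to the identity
    of P identifies Hom(P, Y) with homotopy classes of chain maps ([Q_surj], [Q_inj]). Since A is
    hereditary, the kernel of the free cover is projective, and [resolution] replaces any complex by
    such a P. Exactness then comes from explicit maps into and out of cones ([cone_lift],
    [cone_descend]), and rotation from an explicit homotopy ([cone_out_rotate]). *)

Lemma matrix_ext (k : fieldType) m n (F G : 'M[k]_(m, n)) :
  (forall x : 'cV_n, F *m x = G *m x) -> F = G.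
Proof.
move=> FG; apply/trmx_inj/row_matrixP => i.
by apply: trmx_inj; rewrite -!tr_col !trmxK !colE FG.
Qed.

Lemma surjective_right_inverse (k : fieldType) m n (G : 'M[k]_(m, n)) :
  (forall y : 'cV_m, exists x : 'cV_n, G *m x = y) -> exists S, G *m S = 1%:M.
Proof.
move=> Gs; pose s j := boolp.cid (Gs (col j 1%:M)).
exists (\matrix_(i, j) sval (s j) i 0).
apply/trmx_inj/row_matrixP => j; apply: trmx_inj; rewrite -!tr_col !trmxK.
rewrite -(svalP (s j)) [LHS]colE -mulmxA; congr (_ *m _); rewrite -colE.
by apply/matrixP=> i l; rewrite !mxE (ord1 l).
Qed.

(** * Modules in coordinates: linear maps, kernels, lifting from projectives *)

Section Modules.
Variables (k : closedFieldType) (A : falgType k).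
Implicit Types M N P L : amod A.

Lemma alinear0 M N : @alinear k A M N 0.
Proof. by move=> a; rewrite mul0mx mulmx0. Qed.

Lemma alinear1 M : @alinear k A M M 1%:M.
Proof. by move=> a; rewrite mul1mx mulmx1. Qed.

Lemma alinearD M N (F G : 'M_(adim N, adim M)) :
  alinear F -> alinear G -> alinear (F + G).
Proof. by move=> lF lG a; rewrite mulmxDl mulmxDr lF lG. Qed.

Lemma alinearN M N (F : 'M_(adim N, adim M)) : alinear F -> alinear (- F).
Proof. by move=> lF a; rewrite mulNmx mulmxN lF. Qed.

Lemma alinearB M N (F G : 'M_(adim N, adim M)) :
  alinear F -> alinear G -> alinear (F - G).
Proof. by move=> lF lG; apply/alinearD/alinearN. Qed.

Lemma alinearM L M N (F : 'M_(adim N, adim M)) (G : 'M_(adim M, adim L)) :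
  alinear F -> alinear G -> alinear (F *m G).
Proof. by move=> lF lG a; rewrite -mulmxA lG mulmxA lF mulmxA. Qed.

Lemma alinear_row L M N (F : 'M_(adim N, adim L)) (G : 'M_(adim N, adim M)) :
  alinear F -> alinear G -> @alinear k A (asum L M) N (row_mx F G).
Proof.
move=> lF lG a; rewrite mul_row_block mul_mx_row !mulmx0 addr0 add0r.
by rewrite lF lG.
Qed.

Lemma alinear_col L M N (F : 'M_(adim M, adim L)) (G : 'M_(adim N, adim L)) :
  alinear F -> alinear G -> @alinear k A L (asum M N) (col_mx F G).
Proof.
move=> lF lG a; rewrite mul_block_col mul_col_mx !mul0mx addr0 add0r.
by rewrite lF lG.
Qed.

Lemma alinear_usub L M N (F : 'M_(adim (asum M N), adim L)) :
  alinear F -> @alinear k A L M (usubmx F).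
Proof.
move=> lF a; move: (lF a); rewrite -[F](@vsubmxK _ (adim M)) mul_block_col mul_col_mx.
by rewrite !mul0mx addr0 add0r => /eq_col_mx[]; rewrite col_mxKu.
Qed.

Lemma alinear_dsub L M N (F : 'M_(adim (asum M N), adim L)) :
  alinear F -> @alinear k A L N (dsubmx F).
Proof.
move=> lF a; move: (lF a); rewrite -[F](@vsubmxK _ (adim M)) mul_block_col mul_col_mx.
by rewrite !mul0mx addr0 add0r => /eq_col_mx[]; rewrite col_mxKd.
Qed.

Lemma alinear_lsub L M N (F : 'M_(adim N, adim (asum L M))) :
  alinear F -> @alinear k A L N (lsubmx F).
Proof.
move=> lF a; move: (lF a); rewrite -[F](@hsubmxK _ _ (adim L)) mul_row_block mul_mx_row.
by rewrite !mulmx0 addr0 add0r => /eq_row_mx[]; rewrite row_mxKl.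
Qed.

Lemma alinear_rsub L M N (F : 'M_(adim N, adim (asum L M))) :
  alinear F -> @alinear k A M N (rsubmx F).
Proof.
move=> lF a; move: (lF a); rewrite -[F](@hsubmxK _ _ (adim L)) mul_row_block mul_mx_row.
by rewrite !mulmx0 addr0 add0r => /eq_row_mx[]; rewrite row_mxKr.
Qed.

Lemma projective_asum P1 P2 :
  projective P1 -> projective P2 -> projective (asum P1 P2).
Proof.
move=> p1 p2 M N G F lG sG lF.
have [H1 [l1 e1]] := p1 _ _ G (lsubmx F) lG sG (alinear_lsub lF).
have [H2 [l2 e2]] := p2 _ _ G (rsubmx F) lG sG (alinear_rsub lF).
exists (row_mx H1 H2); split; first exact: alinear_row.
by rewrite mul_mx_row e1 e2 hsubmxK.
Qed.

Section Kernel.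
Variables (m n : nat) (D : 'M[k]_(m, n)).

(** [kermx] is a left kernel, acting on rows, whereas modules here consist of columns; hence the
    transposes. [ker_ret] is a k-linear retraction of the inclusion [ker_inj]. *)
Definition ker_inj : 'M[k]_(n, \rank (kermx D^T)) := (row_base (kermx D^T))^T.
Definition ker_ret : 'M[k]_(\rank (kermx D^T), n) :=
  (pinvmx (row_base (kermx D^T)))^T.

Lemma ker_injK : ker_ret *m ker_inj = 1%:M.
Proof. by rewrite -trmx_mul mulmxVp ?row_base_free // trmx1. Qed.

Lemma mul_ker_inj : D *m ker_inj = 0.
Proof.
apply: trmx_inj; rewrite trmx_mul trmxK trmx0.
by apply/sub_kermxP; rewrite eq_row_base.
Qed.

Lemma ker_retK q (X : 'M_(n, q)) : D *m X = 0 -> ker_inj *m (ker_ret *m X) = X.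
Proof.
move=> DX; apply: trmx_inj; rewrite !trmx_mul !trmxK mulmxKpV //.
by rewrite eq_row_base; apply/sub_kermxP; rewrite -trmx_mul DX trmx0.
Qed.

End Kernel.

Section KernelModule.
Variables (M N : amod A) (D : 'M[k]_(adim N, adim M)).
Hypothesis lD : alinear D.

Definition ker_act (a : A) := ker_ret D *m act M a *m ker_inj D.

Lemma mul_act_ker q (X : 'M_(adim M, q)) a :
  D *m X = 0 -> D *m (act M a *m X) = 0.
Proof. by move=> DX; rewrite mulmxA lD -mulmxA DX mulmx0. Qed.

Lemma ker_inj_act a : ker_inj D *m ker_act a = act M a *m ker_inj D.
Proof. by rewrite /ker_act -!mulmxA ker_retK // mul_act_ker // mul_ker_inj. Qed.

Lemma ker_act_linear : linear ker_act.
Proof.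
move=> c a b.
by rewrite /ker_act act_linear mulmxDr mulmxDl -scalemxAr -scalemxAl.
Qed.

Lemma ker_act1 : ker_act 1 = 1%:M.
Proof. by rewrite /ker_act act1 mulmx1 ker_injK. Qed.

Lemma ker_actM a b : ker_act (a * b) = ker_act a *m ker_act b.
Proof.
by rewrite [ker_act a]/ker_act -[RHS]mulmxA ker_inj_act /ker_act actM !mulmxA.
Qed.

Definition ker_amod : amod A := AMod ker_act_linear ker_act1 ker_actM.

Lemma alinear_ker_inj : @alinear k A ker_amod M (ker_inj D).
Proof. exact: ker_inj_act. Qed.

(** The retraction is a mere k-linear choice, but on maps landing in the kernel it inverts the
    A-linear inclusion. *)
Lemma alinear_ker_ret L (F : 'M_(adim M, adim L)) :
  alinear F -> D *m F = 0 -> @alinear k A L ker_amod (ker_ret D *m F).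
Proof.
move=> lF DF a; rewrite /= /ker_act -!mulmxA ker_retK //.
by rewrite lF.
Qed.

End KernelModule.

(** Exactness at M makes G surjective onto the kernel of D, and F lands in that kernel; projectivity
    is applied to the corestrictions. *)
Lemma projective_lift P L M N (G : 'M_(adim M, adim L)) (D : 'M_(adim N, adim M))
    (F : 'M_(adim M, adim P)) :
  projective P -> alinear G -> alinear D -> alinear F -> D *m G = 0 ->
  (forall x : 'cV_(adim M), D *m x = 0 -> exists y, x = G *m y) ->
  D *m F = 0 -> exists H : 'M_(adim L, adim P), alinear H /\ G *m H = F.
Proof.
move=> pP lG lD lF DG ex DF.
have lG' := alinear_ker_ret lD lG DG; have lF' := alinear_ker_ret lD lF DF.
have sG : @asurjective k A L (ker_amod lD) (ker_ret D *m G).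
  move=> y; have [|x yx] := ex (ker_inj D *m y).
    by rewrite mulmxA mul_ker_inj mul0mx.
  by exists x; rewrite -mulmxA -yx mulmxA ker_injK mul1mx.
have [H [lH GH]] := pP _ _ _ _ lG' sG lF'; exists H; split=> //.
rewrite -[RHS](ker_retK DF) -[ker_ret D *m F]GH mulmxA; congr (_ *m _).
by rewrite ker_retK.
Qed.

End Modules.

(** * Free modules *)

Section LinearMatrix.
Variables (k : fieldType) (p q : nat).

Definition col_fun_mx (f : 'cV[k]_p -> 'cV[k]_q) : 'M[k]_(q, p) :=
  \matrix_(i, j) f (delta_mx j 0) i 0.

Lemma mul_col_fun_mx f x : linear f -> col_fun_mx f *m x = f x.
Proof.
move=> lf; have f0 : f 0 = 0.
  by have := lf (-1) 0 0; rewrite scaler0 addr0 scaleN1r addNr.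
rewrite [in RHS](matrix_sum_delta x).
under [in RHS]eq_bigr do rewrite big_ord1.
have -> : f (\sum_i x i 0 *: delta_mx i 0) = \sum_i x i 0 *: f (delta_mx i 0).
  by elim/big_rec2: _ => // i y1 y2 _ <-; apply: lf.
apply/colP => i; rewrite !mxE summxE; apply: eq_bigr => j _.
by rewrite !mxE mulrC.
Qed.

End LinearMatrix.

Section ColumnVec.
Variables (k : fieldType) (n d : nat).

Definition vcol (M : 'M[k]_(n, d)) : 'cV[k]_(n * d) := (mxvec M)^T.
Definition unvcol (v : 'cV[k]_(n * d)) : 'M[k]_(n, d) := vec_mx v^T.

Lemma vcolK : cancel vcol unvcol.
Proof. by move=> M; rewrite /unvcol trmxK mxvecK. Qed.
Lemma unvcolK : cancel unvcol vcol.
Proof. by move=> v; rewrite /vcol vec_mxK trmxK. Qed.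
Lemma vcol_linear : linear vcol.
Proof. by move=> a u v; rewrite /vcol !linearP. Qed.
Lemma unvcol_linear : linear unvcol.
Proof. by move=> a u v; rewrite /unvcol !linearP. Qed.

End ColumnVec.

Section FreeModule.
Variables (k : closedFieldType) (A : falgType k).

Let d := \dim (fullv : {vspace A}).
Let e (b : 'I_d) : A := (vbasis (fullv : {vspace A}))`_b.
Let coe (a : A) : 'cV[k]_d := \col_c coord (vbasis fullv) c a.

Let coeK a : \sum_b coe a b 0 *: e b = a.
Proof.
by rewrite [RHS](coord_vbasis (memvf a)); apply: eq_bigr => b _; rewrite mxE.
Qed.

Let lmul (a : A) : 'M[k]_d := \matrix_(c, b) coe (a * e b) c 0.

Let lmul_linear : linear lmul.
Proof.
move=> c a b; apply/matrixP => i j; rewrite !mxE mulrDl -scalerAl.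
by rewrite linearP.
Qed.

Let lmul_coe a b : lmul a *m coe b = coe (a * b).
Proof.
apply/colP => i; rewrite -{2}[b]coeK mulr_sumr !mxE linear_sum.
by apply: eq_bigr => j _; rewrite !mxE -scalerAr linearZ /= mulrC.
Qed.

Let coe_e b : coe (e b) = delta_mx b 0.
Proof.
apply/colP => i; rewrite !mxE andbT coord_free 1?eq_sym //.
by rewrite (basis_free (vbasisP _)).
Qed.

Section OnMatrices.
Variable X : amod A.
Notation n := (adim X).

(** The pure tensor of a and x. *)
Let pure (a : A) (x : 'cV[k]_n) : 'M[k]_(n, d) := x *m (coe a)^T.

Let pureE a x i j : pure a x i j = x i 0 * coe a j 0.
Proof. by rewrite mxE big_ord1 [_^T _ _]mxE. Qed.

Let pure_sum (M : 'M[k]_(n, d)) : M = \sum_b pure (e b) (col b M).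
Proof.
apply/matrixP => i j; rewrite summxE (bigD1 j) //= big1 => [|b nbj].
  by rewrite pureE coe_e !mxE !eqxx mulr1 addr0.
by rewrite pureE coe_e !mxE eq_sym (negPf nbj) mulr0.
Qed.

(* A (x)_k X, with the entries of the matrix M standing for the element       *)
(* sum over b of e_b (x) (column b of M).                                     *)
Definition free_act (a : A) : 'M[k]_(n * d) :=
  col_fun_mx (fun v => vcol (unvcol v *m (lmul a)^T)).

Lemma free_actE a v : free_act a *m v = vcol (unvcol v *m (lmul a)^T).
Proof.
apply: mul_col_fun_mx => c u w.
by rewrite unvcol_linear mulmxDl -scalemxAl vcol_linear.
Qed.

Lemma free_act_linear : linear free_act.
Proof.
move=> c a b; apply: matrix_ext => v.
rewrite mulmxDl -scalemxAl !free_actE -vcol_linear lmul_linear.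
by rewrite linearP /= mulmxDr -scalemxAr.
Qed.

Let lmul1 : lmul 1 = 1%:M.
Proof. by apply/matrixP=> i j; rewrite mxE mul1r coe_e !mxE andbT. Qed.

Let lmulM a b : lmul (a * b) = lmul a *m lmul b.
Proof.
apply/matrixP=> i j; rewrite mxE -mulrA -lmul_coe !mxE.
by apply: eq_bigr => l _; rewrite [lmul b l j]mxE.
Qed.

Lemma free_act1 : free_act 1 = 1%:M.
Proof.
by apply: matrix_ext => v; rewrite free_actE lmul1 trmx1 mulmx1 unvcolK mul1mx.
Qed.

Lemma free_actM a b : free_act (a * b) = free_act a *m free_act b.
Proof.
apply: matrix_ext => v; rewrite -mulmxA !free_actE vcolK lmulM.
by rewrite trmx_mul mulmxA.
Qed.

Definition free_amod : amod A := AMod free_act_linear free_act1 free_actM.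

Let act_pure a b x : free_act a *m vcol (pure b x) = vcol (pure (a * b) x).
Proof. by rewrite free_actE vcolK -mulmxA -trmx_mul lmul_coe. Qed.

(** The unit of the free-forgetful adjunction, sending x to the tensor of 1 and x; it is
    k-linear. *)
Definition free_unit : 'M[k]_(n * d, n) := col_fun_mx (fun x => vcol (pure 1 x)).

Let free_unitE x : free_unit *m x = vcol (pure 1 x).
Proof.
by apply: mul_col_fun_mx => c u w; rewrite /pure mulmxDl -scalemxAl vcol_linear.
Qed.

Let pure_ext m (F G : 'M[k]_(m, n * d)) :
  (forall a x, F *m vcol (pure a x) = G *m vcol (pure a x)) -> F = G.
Proof.
move=> FG; apply: matrix_ext => v; rewrite -[v]unvcolK [unvcol v]pure_sum.
elim/big_ind: _ => [||b _]; last exact: FG.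
  by rewrite /vcol !linear0.
by move=> M1 M2 E1 E2; rewrite -[M1]scale1r vcol_linear scale1r !mulmxDr E1 E2.
Qed.

(** The pure tensor of a and x is a times that of 1 and x, so the image of the unit generates the
    free module. *)
Lemma free_ext (N : amod A) (F G : 'M[k]_(adim N, n * d)) :
  @alinear k A free_amod N F -> @alinear k A free_amod N G ->
  F *m free_unit = G *m free_unit -> F = G.
Proof.
move=> lF lG FG; apply: pure_ext => a x.
have -> : vcol (pure a x) = act free_amod a *m (free_unit *m x).
  by rewrite free_unitE /= act_pure mulr1.
rewrite [LHS]mulmxA [RHS]mulmxA lF lG -[LHS]mulmxA -[RHS]mulmxA (mulmxA F) FG.
by rewrite -mulmxA.
Qed.

(** The extension of a k-linear g that sends the tensor of a and x to a (g x), expanded over a basis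
    of A. *)
Definition free_lift (N : amod A) (g : 'M[k]_(adim N, n)) : 'M[k]_(adim N, n * d) :=
  col_fun_mx (fun v => \sum_b act N (e b) *m (g *m col b (unvcol v))).

Let free_lift_pure (N : amod A) (g : 'M[k]_(adim N, n)) a x :
  free_lift g *m vcol (pure a x) = act N a *m (g *m x).
Proof.
rewrite mul_col_fun_mx => [|c u w]; last first.
  rewrite scaler_sumr -big_split; apply: eq_bigr => b _.
  by rewrite unvcol_linear linearP /= mulmxDr mulmxDr -!scalemxAr.
rewrite -[in RHS](coeK a) vcolK.
have -> : act N (\sum_b coe a b 0 *: e b) = \sum_b coe a b 0 *: act N (e b).
  have act0 : act N 0 = 0.
    by have := @act_linear k A N (-1) 0 0; rewrite scaler0 addr0 scaleN1r addNr.
  by elim/big_rec2: _ => // i y1 y2 _ <-; apply: act_linear.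
rewrite mulmx_suml; apply: eq_bigr => b _.
have -> : col b (pure a x) = coe a b 0 *: x.
  by apply/colP => i; rewrite mxE pureE [RHS]mxE mulrC.
by rewrite -!scalemxAr -scalemxAl.
Qed.

Lemma free_lift_alinear (N : amod A) (g : 'M[k]_(adim N, n)) :
  @alinear k A free_amod N (free_lift g).
Proof.
move=> a; apply: pure_ext => b x.
by rewrite -!mulmxA /= act_pure !free_lift_pure actM -!mulmxA.
Qed.

Lemma free_lift_unit (N : amod A) (g : 'M[k]_(adim N, n)) :
  free_lift g *m free_unit = g.
Proof.
by apply: matrix_ext => x; rewrite -mulmxA free_unitE free_lift_pure act1 mul1mx.
Qed.

(** A k-linear section S of G lifts F on the generators, and the adjunction extends this lift to an
    A-linear one. *)
Lemma projective_free : projective free_amod.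
Proof.
move=> M N G F lG /surjective_right_inverse[S GS] lF.
exists (free_lift (S *m (F *m free_unit))); split.
  exact: free_lift_alinear.
apply: free_ext => //; first exact/alinearM/free_lift_alinear.
by rewrite -mulmxA free_lift_unit mulmxA GS mul1mx.
Qed.

Definition free_counit : 'M[k]_(n, n * d) := @free_lift X 1%:M.

End OnMatrices.

(** The tensor product of the identity of A with f. It is A-linear for every k-linear f. *)
Definition free_map (X Y : amod A) (f : 'M[k]_(adim Y, adim X)) :
  'M[k]_(adim (free_amod Y), adim (free_amod X)) :=
  @free_lift X (free_amod Y) (free_unit Y *m f).

Lemma free_map_alinear X Y (f : 'M[k]_(adim Y, adim X)) : alinear (free_map f).
Proof. exact: free_lift_alinear. Qed.

Lemma free_map_unit X Y (f : 'M[k]_(adim Y, adim X)) :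
  free_map f *m free_unit X = free_unit Y *m f.
Proof. exact: free_lift_unit. Qed.

Lemma free_counit_alinear X : @alinear k A (free_amod X) X (free_counit X).
Proof. exact: free_lift_alinear. Qed.

Lemma free_counit_unit X : free_counit X *m free_unit X = 1%:M.
Proof. exact: free_lift_unit. Qed.

Lemma free_mapM X Y Z (g : 'M[k]_(adim Z, adim Y)) (f : 'M[k]_(adim Y, adim X)) :
  free_map (g *m f) = free_map g *m free_map f.
Proof.
apply: free_ext; first exact: free_map_alinear.
  by apply: alinearM; apply: free_map_alinear.
by rewrite -mulmxA !free_map_unit !mulmxA free_map_unit.
Qed.

Lemma free_map0 X Y : free_map (0 : 'M[k]_(adim Y, adim X)) = 0.
Proof.
apply: free_ext; [exact: free_map_alinear|exact: alinear0|].
by rewrite free_map_unit mulmx0 mul0mx.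
Qed.

Lemma free_counit_natural X Y (f : 'M[k]_(adim Y, adim X)) : alinear f ->
  free_counit Y *m free_map f = f *m free_counit X.
Proof.
move=> lf; apply: free_ext.
- exact: (alinearM (@free_counit_alinear Y) (free_map_alinear _)).
- exact: (alinearM lf (@free_counit_alinear X)).
- rewrite -[LHS]mulmxA -[RHS]mulmxA free_map_unit free_counit_unit mulmx1.
  by rewrite mulmxA free_counit_unit mul1mx.
Qed.

End FreeModule.

(** * Homotopies *)

(* Components constructed in degrees i + 1 do not have the type of components *)
(* in an arbitrary degree j, since j is (j - 1) + 1 only propositionally.     *)
Lemma reindex (T : int -> Type) (u : forall i, T (i + 1)) :
  exists v : forall j, T j, forall i, v (i + 1) = u i.
Proof.
exists (fun j => ecast x (T x) (subrK 1 j) (u (j - 1))) => i.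
have cast_u j (e : j + 1 = i + 1) : ecast x (T x) e (u j) = u i.
  have ij : j = i by apply: addIr e.
  by subst j; rewrite eq_axiomK.
exact: cast_u.
Qed.

Lemma succ_int_ind (P : int -> Prop) : (forall i, P (i + 1)) -> forall j, P j.
Proof. by move=> Pi j; rewrite -(subrK 1 j). Qed.

Section ChainMapGroup.
Variables (k : closedFieldType) (A : falgType k).

Section Operations.
Variables X Y : cplx A.

Definition cmap0 : cmap X Y.
Proof.
exists (fun i => 0) => i; first exact: alinear0.
by rewrite mul0mx mulmx0.
Defined.

Definition copp (f : cmap X Y) : cmap X Y.
Proof.
exists (fun i => - cm f i) => i; first exact/alinearN/cm_linear.
by rewrite mulNmx mulmxN cm_comm.
Defined.

Lemma caddA : associative (@cadd k A X Y).
Proof. by move=> f g h; apply: cmap_ext => i; apply: addrA. Qed.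
Lemma caddC : commutative (@cadd k A X Y).
Proof. by move=> f g; apply: cmap_ext => i; apply: addrC. Qed.
Lemma cadd0 : left_id cmap0 (@cadd k A X Y).
Proof. by move=> f; apply: cmap_ext => i; apply: add0r. Qed.
Lemma caddN : left_inverse cmap0 copp (@cadd k A X Y).
Proof. by move=> f; apply: cmap_ext => i; apply: addNr. Qed.

End Operations.

HB.instance Definition _ (X Y : cplx A) := boolp.gen_eqMixin (cmap X Y).
HB.instance Definition _ (X Y : cplx A) := boolp.gen_choiceMixin (cmap X Y).
HB.instance Definition _ (X Y : cplx A) := GRing.isZmodule.Build (cmap X Y)
  (@caddA X Y) (@caddC X Y) (@cadd0 X Y) (@caddN X Y).

Lemma cmD (X Y : cplx A) (f g : cmap X Y) i : cm (f + g) i = cm f i + cm g i.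
Proof. by []. Qed.
Lemma cmN (X Y : cplx A) (f : cmap X Y) i : cm (- f) i = - cm f i.
Proof. by []. Qed.
Lemma cm0 (X Y : cplx A) i : cm (0 : cmap X Y) i = 0.
Proof. by []. Qed.

Lemma ccompBr (X Y Z : cplx A) (g : cmap Y Z) (f f' : cmap X Y) :
  ccomp g (f - f') = ccomp g f - ccomp g f'.
Proof. by apply: cmap_ext => i; apply: mulmxBr. Qed.
Lemma ccompDl (X Y Z : cplx A) (g g' : cmap Y Z) (f : cmap X Y) :
  ccomp (g + g') f = ccomp g f + ccomp g' f.
Proof. by apply: cmap_ext => i; apply: mulmxDl. Qed.
Lemma ccompDr (X Y Z : cplx A) (g : cmap Y Z) (f f' : cmap X Y) :
  ccomp g (f + f') = ccomp g f + ccomp g f'.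
Proof. by apply: cmap_ext => i; apply: mulmxDr. Qed.
Lemma ccompA (X Y Z W : cplx A) (h : cmap Z W) (g : cmap Y Z) (f : cmap X Y) :
  ccomp h (ccomp g f) = ccomp (ccomp h g) f.
Proof. by apply: cmap_ext => i; apply: mulmxA. Qed.
Lemma ccomp1l (X Y : cplx A) (f : cmap X Y) : ccomp (cid Y) f = f.
Proof. by apply: cmap_ext => i; apply: mul1mx. Qed.
Lemma ccomp1r (X Y : cplx A) (f : cmap X Y) : ccomp f (cid X) = f.
Proof. by apply: cmap_ext => i; apply: mulmx1. Qed.

Lemma Q_zmod_morphism (X Y : cplx A) : zmod_morphism (@Q k A X Y : cmap X Y -> Hom X Y).
Proof.
move=> f g; apply/eqP; rewrite eq_sym subr_eq; apply/eqP.
by rewrite -[RHS]Q_add; congr (Q _); rewrite -[LHS](subrK g).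
Qed.

HB.instance Definition _ (X Y : cplx A) :=
  GRing.isZmodMorphism.Build (cmap X Y) (Hom X Y) (@Q k A X Y) (@Q_zmod_morphism X Y).

End ChainMapGroup.

Section Homotopy.
Variables (k : closedFieldType) (A : falgType k).
Implicit Types X Y Z C P : cplx A.

(** Stated in degrees i + 1, which run over all integers, so that h i maps degree i + 1 to degree i
    without casts. *)
Definition nullhomotopic X Y (f : cmap X Y) : Prop :=
  exists h : forall i, 'M[k]_(adim (cob Y i), adim (cob X (i + 1))),
    (forall i, alinear (h i)) /\
    forall i, cm f (i + 1) = cd Y i *m h i + h (i + 1) *m cd X (i + 1).

Definition homotopic X Y (f g : cmap X Y) := nullhomotopic (f - g).

Definition acyclic C : Prop :=
  forall i (x : 'cV[k]_(adim (cob C (i + 1)))),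
    cd C (i + 1) *m x = 0 -> exists x', x = cd C i *m x'.

Definition projective_cplx P : Prop := forall i, projective (cob P i).

Lemma flat_cols m n (F G : 'M[k]_(m, n)) : n = 0%N -> F = G.
Proof. by move=> n0; subst n; rewrite [F]thinmx0 [G]thinmx0. Qed.

(* The homotopy is built by descending induction on the degree, starting      *)
(* where P vanishes.                                                          *)
Lemma nullhomotopic_acyclic P C (f : cmap P C) :
  projective_cplx P -> acyclic C -> nullhomotopic f.
Proof.
move=> pP aC; have [N bP] := cbounded P.
pose rel (h : forall i, 'M[k]_(adim (cob C i), adim (cob P (i + 1)))) i :=
  cm f (i + 1) = cd C i *m h i + h (i + 1) *m cd P (i + 1).
suff H n : exists h : forall i, 'M[k]_(adim (cob C i), adim (cob P (i + 1))),
    (forall i, alinear (h i)) /\ forall i : int, N%:Z <= i + n%:Z -> rel h i.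
  have [h [lh hh]] := H (N + N + 1)%N; exists h; split=> // i.
  have [le_i|lt_i] := lerP (- N%:Z - 1) i; first by apply: hh; lia.
  by apply: flat_cols; apply: bP; lia.
elim: n => [|n [h [lh hh]]].
  exists (fun i => 0); split=> i; first exact: alinear0.
  by move=> le_i; apply: flat_cols; apply: bP; lia.
(* The next degree down: the relation already holds in degrees above j, and changing h at j leaves
   those degrees untouched. *)
pose j : int := N%:Z - n%:Z - 1.
pose F := cm f (j + 1) - h (j + 1) *m cd P (j + 1).
have [||||||H [lH dH]] := @projective_lift k A _ _ _ _ (cd C j) (cd C (j + 1)) F
    (pP (j + 1)).
- exact: cd_linear.
- exact: cd_linear.
- by apply: alinearB; [exact: cm_linear|apply: alinearM; rewrite //; exact: cd_linear].
- exact: cd_square.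
- exact: aC.
- rewrite mulmxBr -cm_comm hh; last by rewrite /j; lia.
  by rewrite mulmxDl -(mulmxA (h _)) cd_square mulmx0 addr0 mulmxA subrr.
exists (dfwith h H); split=> [i|i le_i].
  by case: dfwithP.
rewrite /rel; have [eij|nij] := eqVneq i j; last first.
  by rewrite !dfwith_out ?hh //; move: nij; rewrite /j; lia.
subst i; rewrite dfwith_in dfwith_out ?dH /F ?subrK //.
by rewrite /j; lia.
Qed.

(** A nullhomotopy of g f is exactly the X-component that extends g to a chain map on the cone. *)
Lemma cone_descend X Y Z (f : cmap X Y) (g : cmap Y Z) :
  nullhomotopic (ccomp g f) ->
  exists g' : cmap (cone f) Z, ccomp g' (cone_in f) = g.
Proof.
case=> h [lh hh].
have lg i : @alinear k A (cob (cone f) i) (cob Z i) (row_mx (h i) (cm g i)).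
  by apply: alinear_row; rewrite //; apply: cm_linear.
have dg i : row_mx (h (i + 1)) (cm g (i + 1)) *m cd (cone f) i =
    cd Z i *m row_mx (h i) (cm g i).
  rewrite mul_row_block mul_mx_row mulmx0 add0r cm_comm mulmxN.
  by have /= -> := hh i; congr row_mx; rewrite [LHS]addrC addrK.
exists (CMap lg dg); apply: cmap_ext => i /=.
by rewrite mul_row_col mulmx0 add0r mulmx1.
Qed.

(** The two components of the nullhomotopy play different roles: the one into X is the chain map g',
    the one into Y is the homotopy from g to f g'. *)
Lemma cone_lift X Y Z (f : cmap X Y) (g : cmap Z Y) :
  nullhomotopic (ccomp (cone_in f) g) -> exists g', homotopic g (ccomp f g').
Proof.
case=> h [lh hh].
pose a i := usubmx (h i : 'M_(adim (cob X (i + 1)) + adim (cob Y i), _)).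
pose b i := dsubmx (h i : 'M_(adim (cob X (i + 1)) + adim (cob Y i), _)).
have la i : @alinear k A (cob Z (i + 1)) (cob X (i + 1)) (a i).
  exact: (@alinear_usub k A _ (cob X (i + 1)) (cob Y i) _ (lh i)).
have lb i : @alinear k A (cob Z (i + 1)) (cob Y i) (b i).
  exact: (@alinear_dsub k A _ (cob X (i + 1)) (cob Y i) _ (lh i)).
have hE i : h i = col_mx (a i) (b i) by rewrite vsubmxK.
have ab i : a (i + 1) *m cd Z (i + 1) = cd X (i + 1) *m a i /\
    cm g (i + 1) = cm f (i + 1) *m a i + cd Y i *m b i + b (i + 1) *m cd Z (i + 1).
  have := hh i; rewrite /= !hE mul_col_mx mul_block_col mul_col_mx add_col_mx.
  rewrite mul0mx mul1mx mul0mx addr0 mulNmx => /eq_col_mx[/esym/eqP].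
  by rewrite [X in X == _]addrC subr_eq0 => /eqP.
have [c cE] := @reindex (fun i => 'M[k]_(adim (cob X i), adim (cob Z i))) a.
have lc : forall i, @alinear k A (cob Z i) (cob X i) (c i).
  by apply: succ_int_ind => i; rewrite cE.
have dc : forall i, c (i + 1) *m cd Z i = cd X i *m c i.
  by apply: succ_int_ind => i; rewrite !cE; case: (ab i).
exists (CMap lc dc), b; split=> // i; rewrite cmD cmN /= cE; have [_ ->] := ab i.
by rewrite -[X in X - _]addrA [X in X - _]addrC addrK.
Qed.

(** For a cycle (u, v), injectivity bounds u by some u'; then v + s u' is a cycle, and surjectivity
    expresses it through X up to a boundary. *)
Lemma quasi_iso_acyclic X Y (s : cmap X Y) : quasi_iso s -> acyclic (cone s).
Proof.
case=> inj surj i x.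
rewrite -[x](@vsubmxK _ (adim (cob X (i + 1 + 1)))).
set u := usubmx _; set v := dsubmx _.
rewrite /= /cone_d mul_block_col mul0mx addr0 -[0]col_mx0 => /eq_col_mx[du uv].
have {}du : cd X (i + 1 + 1) *m u = 0.
  by apply/eqP; rewrite -oppr_eq0 -mulNmx du.
have [|u' uE] := inj _ u (- v) du.
  by apply/eqP; rewrite mulmxN -addr_eq0 uv.
have [|x'' [y [dx'' yE]]] := surj i (v + cm s (i + 1) *m u').
  by rewrite mulmxDr mulmxA -cm_comm -mulmxA -uE [LHS]addrC.
exists (col_mx (x'' - u') y); rewrite mul_block_col mul0mx addr0.
congr col_mx; first by rewrite mulNmx mulmxBr dx'' sub0r opprK.
by rewrite mulmxBr addrAC -yE addrK.
Qed.

Lemma quasi_iso_id X : quasi_iso (cid X).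
Proof.
split=> i /=; first by move=> x y _; rewrite mul1mx => ->; exists y.
move=> y dy.
by exists y, 0; rewrite mul1mx mulmx0 addr0.
Qed.

(* The zero endomorphism of an acyclic complex is a quasi-isomorphism.        *)
Lemma acyclic_hid C : acyclic C -> hid C = 0.
Proof.
move=> aC; have z : quasi_iso (0 : cmap C C).
  split=> i; first by move=> x y dx _; apply: aC.
  move=> y dy.
  have [y' ->] := aC _ _ dy; exists 0, y'.
  by rewrite !mulmx0 add0r.
have <- : hcomp (hclass (winv z)) (Q (0 : cmap C C)) = hid C.
  by rewrite hcompE; apply/hclassP/weq_invl.
by rewrite [Q _]raddf0 hcomp0r.
Qed.

(** A nullhomotopic map factors through the cone of an identity, which is acyclic and hence zero in
    [Db]. *)
Lemma Q_nullhomotopic X Y (f : cmap X Y) : nullhomotopic f -> Q f = 0.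
Proof.
rewrite -{1}[f]ccomp1r => /cone_descend[g <-].
rewrite Q_comp -[Q (cone_in _)]hcomp_idl acyclic_hid ?hcomp0l ?hcomp0r //.
exact/quasi_iso_acyclic/quasi_iso_id.
Qed.

Lemma Q_homotopic X Y (f g : cmap X Y) : homotopic f g -> Q f = Q g.
Proof.
by move/Q_nullhomotopic/eqP; rewrite [Q _]raddfB subr_eq0 => /eqP.
Qed.

End Homotopy.

(** * Morphisms out of complexes of projectives *)

Section Resolved.
Variables (k : closedFieldType) (A : falgType k).
Implicit Types X Y Z C P : cplx A.

Lemma hcompNl X Y Z (g : Hom Y Z) (f : Hom X Y) : hcomp (- g) f = - hcomp g f.
Proof. by rewrite -[- g]sub0r hcompBl hcomp0l sub0r. Qed.

Lemma hcompNr X Y Z (g : Hom Y Z) (f : Hom X Y) : hcomp g (- f) = - hcomp g f.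
Proof. by rewrite -[- f]sub0r hcompBr hcomp0r sub0r. Qed.

Lemma hcomp_suml X Y Z I (r : seq I) (F : I -> Hom Y Z) (f : Hom X Y) :
  hcomp (\sum_(i <- r) F i) f = \sum_(i <- r) hcomp (F i) f.
Proof.
apply: (big_morph (fun g : Hom Y Z => hcomp g f)) => [x y|].
  exact: hcompDl.
exact: hcomp0l.
Qed.

Lemma hcomp_sumr X Y Z I (r : seq I) (g : Hom Y Z) (F : I -> Hom X Y) :
  hcomp g (\sum_(i <- r) F i) = \sum_(i <- r) hcomp g (F i).
Proof.
apply: (big_morph (hcomp g)) => [x y|]; first exact: hcompDr.
exact: hcomp0r.
Qed.

Lemma Q_invl X Y (s : cmap X Y) (hs : quasi_iso s) :
  hcomp (hclass (winv hs)) (Q s) = hid X.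
Proof. by rewrite hcompE; apply/hclassP/weq_invl. Qed.

Lemma Q_invr X Y (s : cmap X Y) (hs : quasi_iso s) :
  hcomp (Q s) (hclass (winv hs)) = hid Y.
Proof. by rewrite hcompE; apply/hclassP/weq_invr. Qed.

Lemma Q_is_iso X Y (s : cmap X Y) : quasi_iso s -> is_iso (Q s).
Proof.
by move=> hs; exists (hclass (winv hs)); split; [apply: Q_invl|apply: Q_invr].
Qed.

Lemma nullhomotopic0 X Y : nullhomotopic (0 : cmap X Y).
Proof.
exists (fun i => 0); split=> i; first exact: alinear0.
by rewrite cm0 mulmx0 mul0mx addr0.
Qed.

Lemma nullhomotopicB X Y (f g : cmap X Y) :
  nullhomotopic f -> nullhomotopic g -> nullhomotopic (f - g).
Proof.
case=> h [lh hh] [h' [lh' hh']]; exists (fun i => h i - h' i).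
split=> i; first exact: alinearB.
rewrite cmD cmN hh hh' mulmxBr mulmxBl opprD !addrA; congr (_ - _).
by rewrite addrAC.
Qed.

Lemma nullhomotopicN X Y (f : cmap X Y) : nullhomotopic f -> nullhomotopic (- f).
Proof. by move/(nullhomotopicB (nullhomotopic0 X Y)); rewrite sub0r. Qed.

Lemma nullhomotopicD X Y (f g : cmap X Y) :
  nullhomotopic f -> nullhomotopic g -> nullhomotopic (f + g).
Proof. by move=> nf /nullhomotopicN/(nullhomotopicB nf); rewrite opprK. Qed.

Lemma nullhomotopic_compl X Y Z (g : cmap Y Z) (f : cmap X Y) :
  nullhomotopic f -> nullhomotopic (ccomp g f).
Proof.
case=> h [lh hh]; exists (fun i => cm g i *m h i); split=> i.
  by apply: alinearM; rewrite //; exact: cm_linear.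
by rewrite /= hh mulmxDr !mulmxA cm_comm.
Qed.

Lemma homotopic_refl X Y (f : cmap X Y) : homotopic f f.
Proof. by rewrite /homotopic subrr; apply: nullhomotopic0. Qed.

Lemma homotopic_sym X Y (f g : cmap X Y) : homotopic f g -> homotopic g f.
Proof. by move/nullhomotopicN; rewrite opprB. Qed.

Lemma homotopic_trans X Y (f g h : cmap X Y) :
  homotopic f g -> homotopic g h -> homotopic f h.
Proof. by move=> /nullhomotopicD H /H; rewrite addrA subrK. Qed.

Lemma homotopicD X Y (f g f' g' : cmap X Y) :
  homotopic f g -> homotopic f' g' -> homotopic (f + f') (g + g').
Proof. by move=> /nullhomotopicD H /H; rewrite /homotopic opprD addrACA. Qed.

Lemma homotopicN X Y (f g : cmap X Y) :
  homotopic f g -> homotopic (- f) (- g).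
Proof. by move/nullhomotopicN; rewrite /homotopic opprD. Qed.

Lemma homotopic_compl X Y Z (h : cmap Y Z) (f g : cmap X Y) :
  homotopic f g -> homotopic (ccomp h f) (ccomp h g).
Proof. by move/(nullhomotopic_compl h); rewrite ccompBr. Qed.

Lemma homotopic_refl_eq X Y (f g : cmap X Y) : f = g -> homotopic f g.
Proof. by move->; apply: homotopic_refl. Qed.

Section FixP.
Variable P : cplx A.
Hypothesis pP : projective_cplx P.

Lemma quasi_iso_lift X Y (s : cmap X Y) (hs : quasi_iso s) (g : cmap P Y) :
  exists g', homotopic g (ccomp s g').
Proof. exact/cone_lift/nullhomotopic_acyclic/quasi_iso_acyclic. Qed.

(** Together, g and the nullhomotopy h of s g form a chain map (g, -h) from P[1] to the acyclic cone
    of s. It is nullhomotopic, and the X-component of its homotopy contracts g up to sign. *)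
Lemma quasi_iso_nullhomotopic X Y (s : cmap X Y) (g : cmap P X) :
  quasi_iso s -> nullhomotopic (ccomp s g) -> nullhomotopic g.
Proof.
move=> hs [h [lh hh]].
pose phi i : 'M_(adim (cob (cone s) i), adim (cob (shift P) i)) :=
  col_mx (cm g (i + 1)) (- h i).
have lphi i : @alinear k A (cob (shift P) i) (cob (cone s) i) (phi i).
  by apply: alinear_col; [exact: cm_linear|exact/alinearN/lh].
have dphi i : phi (i + 1) *m cd (shift P) i = cd (cone s) i *m phi i.
  rewrite mul_block_col mul_col_mx /= mul0mx addr0.
  congr col_mx; first by rewrite mulmxN mulNmx cm_comm.
  have /= -> := hh i; rewrite !mulmxN mulNmx opprK.
  by rewrite [X in _ = X - _]addrC addrK.
have [|H [lH hH]] := @nullhomotopic_acyclic k A (shift P) _ (CMap lphi dphi) _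
  (quasi_iso_acyclic hs); first by move=> i; apply: pP.
pose a i := usubmx (H i : 'M_(adim (cob X (i + 1)) + adim (cob Y i), _)).
have la i : @alinear k A (cob P (i + 1 + 1)) (cob X (i + 1)) (a i).
  exact: (@alinear_usub k A _ (cob X (i + 1)) (cob Y i) _ (lH i)).
have [c cE] := @reindex (fun i => 'M[k]_(adim (cob X i), adim (cob P (i + 1)))) a.
exists (fun i => - c i); split; apply: succ_int_ind => i; rewrite ?cE.
  exact: alinearN.
have := congr1 usubmx (hH i).
rewrite /= col_mxKu => ->; rewrite linearD /=.
rewrite -[H i](@vsubmxK _ (adim (cob X (i + 1)))) mul_block_col mul0mx addr0.
rewrite col_mxKu; congr (_ + _); first by rewrite mulmxN mulNmx.
by rewrite mulNmx -[RHS]mulmxN; apply/esym/mul_usub_mx.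
Qed.

Lemma quasi_iso_homotopic X Y (s : cmap X Y) (f g : cmap P X) :
  quasi_iso s -> homotopic (ccomp s f) (ccomp s g) -> homotopic f g.
Proof. by rewrite /homotopic -ccompBr; apply: quasi_iso_nullhomotopic. Qed.

(* Homotopy classes of maps from P send quasi-isomorphisms to bijections, so  *)
(* words act on them; this invariant detects when Q f vanishes.               *)
Fixpoint ev X Y (u : word X Y) : cmap P X -> cmap P Y :=
  match u in word X Y return cmap P X -> cmap P Y with
  | wmap _ _ f => ccomp f
  | winv _ _ s hs => fun p => sval (boolp.cid (quasi_iso_lift hs p))
  | wcomp _ _ _ v u => fun p => ev v (ev u p)
  | wzero _ _ => fun=> 0
  | wopp _ _ u => fun p => - ev u p
  | wadd _ _ u v => fun p => ev u p + ev v p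
  end.

Lemma ev_winv X Y (s : cmap X Y) (hs : quasi_iso s) (p : cmap P Y) :
  homotopic p (ccomp s (ev (winv hs) p)).
Proof. by rewrite /=; case: boolp.cid. Qed.

Lemma Q_ev X Y (u : word X Y) (p : cmap P X) :
  Q (ev u p) = hcomp (hclass u) (Q p).
Proof.
elim: u p => [X' Y' f|X' Y' s hs|X' Y' Z v IHv u IHu|X' Y'|X' Y' u IHu
             |X' Y' u IHu v IHv] p.
- exact: Q_comp.
- have /Q_homotopic -> := ev_winv hs p; rewrite Q_comp hcompA Q_invl.
  by rewrite hcomp_idl.
- by rewrite [LHS]IHv IHu hcompA hcompE.
- by rewrite [LHS]raddf0 -[hclass _]/(0 : Hom _ _) hcomp0l.
- rewrite [LHS]raddfN [X in - X]IHu -hoppE -[hopp _]/(- hclass u).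
  by rewrite hcompNl.
- rewrite [LHS]raddfD [X in X + _]IHu [X in _ + X]IHv -haddE.
  by rewrite -[hadd _ _]/(hclass u + hclass v) hcompDl.
Qed.

Lemma Q_surj X (f : Hom P X) : exists g : cmap P X, f = Q g.
Proof.
have [u ->] := hclass_surj f; exists (ev u (cid P)).
by rewrite Q_ev [RHS]hcomp_idr.
Qed.

Lemma ev_homotopic X Y (u : word X Y) p q :
  homotopic p q -> homotopic (ev u p) (ev u q).
Proof.
elim: u p q => [X' Y' f|X' Y' s hs|X' Y' Z v IHv u IHu|X' Y'|X' Y' u IHu
               |X' Y' u IHu v IHv] p q pq.
- exact: homotopic_compl.
- apply: (quasi_iso_homotopic hs).
  apply: homotopic_trans (ev_winv hs q).
  exact: homotopic_trans (homotopic_sym (ev_winv hs p)) pq.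
- exact/IHv/IHu.
- exact: homotopic_refl.
- exact/homotopicN/IHu.
- by apply: homotopicD; [apply: IHu|apply: IHv].
Qed.

Lemma evD X Y (u : word X Y) p q :
  homotopic (ev u (p + q)) (ev u p + ev u q).
Proof.
elim: u p q => [X' Y' f|X' Y' s hs|X' Y' Z v IHv u IHu|X' Y'|X' Y' u IHu
               |X' Y' u IHu v IHv] p q.
- by apply: homotopic_refl_eq; apply: ccompDr.
- apply: (quasi_iso_homotopic hs); rewrite ccompDr.
  apply: homotopic_trans (homotopic_sym (ev_winv hs _)) _.
  exact: homotopicD (ev_winv hs p) (ev_winv hs q).
- exact: homotopic_trans (ev_homotopic v (IHu p q)) (IHv _ _).
- by rewrite /= addr0; apply: homotopic_refl.
- by rewrite /= -opprD; apply/homotopicN/IHu.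
- by rewrite /= addrACA; apply: homotopicD.
Qed.

Lemma ev_weq X Y (u v : word X Y) p : weq u v -> homotopic (ev u p) (ev v p).
Proof.
move=> uv; elim: uv p => {X Y u v}.
- by move=> *; apply: homotopic_refl.
- by move=> X Y u v _ IH p; apply/homotopic_sym.
- by move=> X Y u v w _ IH _ IH' p; apply: homotopic_trans (IH p) (IH' p).
- move=> X Y Z v v' u u' _ IH _ IH' p.
  exact: homotopic_trans (ev_homotopic v (IH' p)) (IH _).
- by move=> X Y u u' _ IH p; apply/homotopicN.
- by move=> X Y u u' v v' _ IH _ IH' p; apply: homotopicD.
- by move=> *; apply: homotopic_refl.
- by move=> *; apply/homotopic_refl_eq/ccomp1l.
- by move=> X Y u p /=; rewrite ccomp1l; apply: homotopic_refl.
- by move=> *; apply/homotopic_refl_eq/addrA.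
- by move=> *; apply/homotopic_refl_eq/addrC.
- by move=> *; apply/homotopic_refl_eq/add0r.
- by move=> *; apply/homotopic_refl_eq/addNr.
- by move=> *; apply/homotopic_refl.
- by move=> *; apply: evD.
- by move=> *; apply/homotopic_refl_eq/esym/ccompA.
- by move=> *; apply/homotopic_refl_eq/ccompDl.
- move=> X Y s hs p; apply: (quasi_iso_homotopic hs).
  rewrite /= ccomp1l; exact/homotopic_sym/(ev_winv hs).
- move=> X Y s hs p; rewrite /= ccomp1l; exact/homotopic_sym/(ev_winv hs).
Qed.

Lemma Q_inj X (f g : cmap P X) : Q f = Q g -> homotopic f g.
Proof. by move/hclassP/(ev_weq (cid P)); rewrite /= !ccomp1r. Qed.

Lemma Q_eq0 X (f : cmap P X) : Q f = 0 -> nullhomotopic f.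
Proof. by rewrite -[0](raddf0 (@Q k A P X)) => /Q_inj; rewrite /homotopic subr0. Qed.

End FixP.
End Resolved.

(** * Projective resolutions *)

(* The free cover A (x)_k X -> X is functorial in X, so it covers the whole   *)
(* complex; its kernel is projective since A is hereditary, and the cone of   *)
(* the inclusion of the kernel resolves X.                                    *)
Section Resolution.
Variables (k : closedFieldType) (A : falgType k).
Variable X : cplx A.

Let counit i := free_counit (cob X i).
Let lcounit i : @alinear k A (free_amod (cob X i)) (cob X i) (counit i).
Proof. exact: free_counit_alinear. Qed.

Lemma free_cplx_square i :
  free_map (cd X (i + 1)) *m free_map (cd X i) = 0.
Proof. by rewrite -free_mapM cd_square free_map0. Qed.

Lemma free_cplx_bounded : exists n : nat, forall i, (n < `|i|)%N ->
  adim (free_amod (cob X i)) = 0%N.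
Proof. by have [n bX] := cbounded X; exists n => i /bX /= ->. Qed.

Definition free_cplx : cplx A :=
  Cplx (fun i => free_map_alinear (cd X i)) free_cplx_square free_cplx_bounded.

Definition ker_d i := ker_ret (counit (i + 1)) *m
  (free_map (cd X i) *m ker_inj (counit i)).

Let counit_d i :
  counit (i + 1) *m (free_map (cd X i) *m ker_inj (counit i)) = 0.
Proof.
rewrite mulmxA free_counit_natural; last exact: cd_linear.
by rewrite -mulmxA mul_ker_inj mulmx0.
Qed.

Lemma ker_inj_d i :
  ker_inj (counit (i + 1)) *m ker_d i = free_map (cd X i) *m ker_inj (counit i).
Proof. exact/ker_retK/counit_d. Qed.

Lemma ker_d_alinear i :
  @alinear k A (ker_amod (lcounit i)) (ker_amod (lcounit (i + 1))) (ker_d i).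
Proof.
apply: alinear_ker_ret; last exact: counit_d.
exact: (alinearM (free_map_alinear _) (alinear_ker_inj (lcounit i))).
Qed.

Let ker_injI i q : injective (@mulmx k _ _ q (ker_inj (counit i))).
Proof.
move=> F G /(congr1 (mulmx (ker_ret (counit i)))).
by rewrite !mulmxA ker_injK !mul1mx.
Qed.

Lemma ker_d_square i : ker_d (i + 1) *m ker_d i = 0.
Proof.
apply: ker_injI; rewrite mulmxA ker_inj_d -mulmxA ker_inj_d mulmxA.
by rewrite free_cplx_square mul0mx mulmx0.
Qed.

Lemma ker_cplx_bounded : exists n : nat, forall i, (n < `|i|)%N ->
  adim (ker_amod (lcounit i)) = 0%N.
Proof.
have [n bF] := free_cplx_bounded; exists n => i /bF /= F0.
by apply/eqP; rewrite -leqn0 -F0 rank_leq_col.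
Qed.

Definition ker_cplx : cplx A := Cplx ker_d_alinear ker_d_square ker_cplx_bounded.

Definition ker_map : cmap ker_cplx free_cplx :=
  @CMap k A ker_cplx free_cplx _ (fun i => alinear_ker_inj (lcounit i)) ker_inj_d.

Definition resolution : cplx A := cone ker_map.

Lemma resolution_projective : hereditary A -> projective_cplx resolution.
Proof.
move=> hA i; apply: projective_asum; last exact: projective_free.
apply: (hA _ _ _ (@projective_free _ _ _) (alinear_ker_inj (lcounit (i + 1)))).
exact: ker_injI.
Qed.

Definition resolution_cm i :
  'M[k]_(adim (cob X i), adim (cob resolution i)) := row_mx 0 (counit i).

Lemma resolution_cm_alinear i : alinear (resolution_cm i).
Proof. exact: (alinear_row (@alinear0 _ _ _ _) (lcounit i)). Qed.

Lemma resolution_cm_comm i :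
  resolution_cm (i + 1) *m cd resolution i = cd X i *m resolution_cm i.
Proof.
rewrite mul_row_block mul_mx_row !mul0mx mulmx0 !add0r /=.
by rewrite mul_ker_inj free_counit_natural //; apply: cd_linear.
Qed.

Definition resolution_map : cmap resolution X :=
  CMap resolution_cm_alinear resolution_cm_comm.

Let counit_surj i (y : 'cV_(adim (cob X i))) : exists x, y = counit i *m x.
Proof. by exists (free_unit _ *m y); rewrite mulmxA free_counit_unit mul1mx. Qed.

(** The free cover is surjective in each degree and its kernel has been coned off; z is always the
    element of the kernel that corrects the chosen preimage. *)
Lemma resolution_quasi_iso : quasi_iso resolution_map.
Proof.
split=> i; last first.
  move=> y; have [x ->] := counit_surj y => dx.
  have /ker_retK : counit (i + 1 + 1) *m (free_map (cd X (i + 1)) *m x) = 0.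
    by rewrite mulmxA free_counit_natural ?dx -?mulmxA //; apply: cd_linear.
  set z := ker_ret _ *m _ => zE.
  exists (col_mx (- z) x), 0; rewrite mulmx0 addr0; split; last first.
    by rewrite mul_row_col mul0mx add0r.
  rewrite /= mul_block_col !mul0mx addr0 mulmxN mulNmx opprK mulmxN zE addNr.
  rewrite -[RHS]col_mx0; congr col_mx; apply: ker_injI.
  by rewrite mulmxA ker_inj_d -mulmxA zE mulmxA free_cplx_square mul0mx mulmx0.
move=> x; rewrite -[x](@vsubmxK _ (adim (cob ker_cplx (i + 1 + 1)))).
set u := usubmx _; set v := dsubmx _ => y.
rewrite /= mul_block_col mul0mx addr0 -[0]col_mx0 => /eq_col_mx[du uv].
have [x' ->] := counit_surj y; rewrite mul_row_col mul0mx add0r => vx.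
have /ker_retK : counit (i + 1) *m (v - free_map (cd X i) *m x') = 0.
  rewrite mulmxBr [X in X - _]vx !mulmxA free_counit_natural ?subrr //.
  exact: cd_linear.
set z := ker_ret _ *m _ => zE.
exists (col_mx z x'); rewrite mul_block_col mul0mx addr0; congr col_mx.
  apply: ker_injI.
  rewrite mulNmx mulmxN mulmxA ker_inj_d -mulmxA zE mulmxBr mulmxA.
  rewrite free_cplx_square mul0mx subr0; apply/eqP; rewrite -addr_eq0.
  by rewrite uv.
by rewrite zE subrK.
Qed.

End Resolution.

Lemma projective_resolution (k : closedFieldType) (A : falgType k) (X : cplx A) :
  hereditary A ->
  exists P (p : cmap P X), projective_cplx P /\ quasi_iso p.
Proof.
move=> hA; exists (resolution X), (resolution_map X); split.
  exact: resolution_projective.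
exact: resolution_quasi_iso.
Qed.

(** * Maps between cones, and rotation of a cone *)

Lemma addmxE (R : nmodType) m n (F G : 'M[R]_(m, n)) i j :
  (F + G) i j = F i j + G i j.
Proof. exact: mxE. Qed.

Lemma oppmxE (R : zmodType) m n (F : 'M[R]_(m, n)) i j : (- F) i j = - F i j.
Proof. exact: mxE. Qed.

Lemma mx0E (R : nmodType) m n i j : (0 : 'M[R]_(m, n)) i j = 0.
Proof. exact: mxE. Qed.

Ltac mx_abel := apply/matrixP => ? ?; rewrite !(addmxE, oppmxE, mx0E); ring.

(* A square commuting up to the homotopy c induces the lower triangular map   *)
(* with diagonal entries q, r and off-diagonal entry c between the cones.     *)
Section ConeMap.
Variables (k : closedFieldType) (A : falgType k).
Variables (X Y P R : cplx A) (f : cmap X Y) (f' : cmap P R).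
Variables (q : cmap P X) (r : cmap R Y).

Lemma homotopic_cone_map : homotopic (ccomp r f') (ccomp f q) ->
  quasi_iso q -> quasi_iso r ->
  exists g : cmap (cone f') (cone f), quasi_iso g /\
    ccomp g (cone_in f') = ccomp (cone_in f) r.
Proof.
case=> c [lc hc] [qinj qsurj] [rinj rsurj].
have {}hc i : cm r (i + 1) *m cm f' (i + 1) = cm f (i + 1) *m cm q (i + 1) +
    cd Y i *m c i + c (i + 1) *m cd P (i + 1).
  by rewrite -addrA -hc cmD cmN /= subrKC.
pose g i : 'M_(adim (cob (cone f) i), adim (cob (cone f') i)) :=
  block_mx (cm q (i + 1)) 0 (c i) (cm r i).
have lg i : @alinear k A (cob (cone f') i) (cob (cone f) i) (g i).
  rewrite /g -[block_mx _ _ _ _]/(col_mx _ _); apply: alinear_col.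
    by apply: alinear_row; [exact: cm_linear|exact: alinear0].
  by apply: alinear_row; [exact: lc|exact: cm_linear].
have dg i : g (i + 1) *m cd (cone f') i = cd (cone f) i *m g i.
  rewrite !mulmx_block !mulmx0 !mul0mx !addr0 !add0r hc mulmxN mulNmx !cm_comm.
  by congr block_mx; rewrite mulmxN; mx_abel.
exists (CMap lg dg); split; last first.
  apply: cmap_ext => i /=; rewrite mul_block_col mul_col_mx !mulmx0 !mul0mx.
  by rewrite !add0r mul1mx mulmx1.
(* The five lemma on elements: injectivity on cohomology, then surjectivity. *)
split=> i.
  move=> z w; rewrite -[z](@vsubmxK _ (adim (cob P (i + 1 + 1)))).
  rewrite -[w](@vsubmxK _ (adim (cob X (i + 1)))).
  move: (usubmx z) (dsubmx z) (usubmx w) (dsubmx w) => x y u v {z w}.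
  rewrite /= !mul_block_col !mul0mx !addr0 -[0]col_mx0.
  move=> /eq_col_mx[/eqP]; rewrite mulNmx oppr_eq0 => /eqP dx fxy.
  move=> /eq_col_mx[qx cxry].
  have [|x' xE] := qinj _ x (- u) dx; first by rewrite qx mulNmx mulmxN.
  (* Replacing x' by x' - z, with z a cycle, still bounds x; it turns the remaining obstruction in R
     into a cycle whose image under r is a boundary. *)
  have [|z [w [dz uE]]] := qsurj i (u + cm q (i + 1) *m x').
    rewrite mulmxDr mulmxA -cm_comm -mulmxA -xE qx mulNmx; exact: subrr.
  have rf' : cm r (i + 1) *m (cm f' (i + 1) *m (x' - z)) =
      cm f (i + 1) *m (cm q (i + 1) *m (x' - z)) + cd Y i *m (c i *m (x' - z)) +
      c (i + 1) *m x.
    by rewrite mulmxA hc !mulmxDl -!mulmxA (mulmxBr (cd P (i + 1))) -xE dz subr0.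
  have ry : cm r (i + 1) *m y = cm f (i + 1) *m u + cd Y i *m v - c (i + 1) *m x.
    by apply/eqP; rewrite -subr_eq opprK -cxry [X in _ == X]addrC.
  have {}uE : u = cm q (i + 1) *m z + cd X i *m w - cm q (i + 1) *m x'.
    by rewrite -uE addrK.
  have fdw : cm f (i + 1) *m (cd X i *m w) = cd Y i *m (cm f i *m w).
    by rewrite !mulmxA cm_comm.
  have [||y' yE] := rinj i (y + cm f' (i + 1) *m (x' - z))
    (cm f i *m w + v + c i *m (x' - z)).
  - rewrite mulmxDr mulmxA -cm_comm -mulmxA mulmxBr -xE dz subr0.
    by rewrite [LHS]addrC.
  - rewrite [LHS]mulmxDr rf' ry uE !(mulmxDr, mulmxN) fdw; mx_abel.
  exists (col_mx (z - x') y'); rewrite mul_block_col mul0mx addr0.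
  congr col_mx; first by rewrite mulNmx mulmxBr dz sub0r opprK.
  by rewrite -yE !mulmxBr; mx_abel.
move=> z; rewrite -[z](@vsubmxK _ (adim (cob X (i + 1 + 1)))).
move: (usubmx z) (dsubmx z) => u v {z}.
rewrite /= !mul_block_col !mul0mx !addr0 -[0]col_mx0.
move=> /eq_col_mx[/eqP]; rewrite mulNmx oppr_eq0 => /eqP du fudv.
have [x [u0 [dx uE]]] := qsurj _ u du.
have rf' : cm r (i + 1 + 1) *m (cm f' (i + 1 + 1) *m x) =
    cd Y (i + 1) *m (c (i + 1) *m x - cm f (i + 1) *m u0 - v).
  rewrite mulmxA hc !mulmxDl -!mulmxA dx mulmx0 addr0 !mulmxBr.
  have -> : cd Y (i + 1) *m v = - (cm f (i + 1 + 1) *m u).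
    by apply/eqP; rewrite -addr_eq0 [X in X == _]addrC fudv.
  have -> : cd Y (i + 1) *m (cm f (i + 1) *m u0) =
      cm f (i + 1 + 1) *m (cd X (i + 1) *m u0) by rewrite !mulmxA cm_comm.
  rewrite uE mulmxDr; mx_abel.
have [|y0 y0E] := rinj _ _ _ _ rf'.
  by rewrite mulmxA -cm_comm -mulmxA dx mulmx0.
have [|y1 [v1 [dy1 vE]]] := rsurj i
  (v - c (i + 1) *m x + cm r (i + 1) *m y0 + cm f (i + 1) *m u0).
  have := rf'; rewrite y0E mulmxA cm_comm -mulmxA !mulmxDr !mulmxN => ->.
  by mx_abel.
exists (col_mx x (y1 - y0)), (col_mx (- u0) v1).
rewrite !mul_block_col !mul0mx !addr0 [- _ *m x]mulNmx dx oppr0 mulmxBr dy1 y0E sub0r.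
split; first by rewrite [X in col_mx _ X]addrN col_mx0.
rewrite add_col_mx; congr col_mx.
  by rewrite mulmxN mulNmx opprK.
have -> : v = cm r (i + 1) *m y1 + cd Y i *m v1 - cm f (i + 1) *m u0 -
    cm r (i + 1) *m y0 + c (i + 1) *m x by rewrite -vE; mx_abel.
by rewrite mulmxBr mulmxN; mx_abel.
Qed.

End ConeMap.

Section Rotation.
Variables (k : closedFieldType) (A : falgType k).
Variables (X Y : cplx A) (f : cmap X Y).

(** The projection of Y^(i+1) (+) X^(i+1) (+) Y^i onto X^(i+1). Its kernel is the cone of the
    identity of Y, which is why it is a quasi-isomorphism. *)
Definition cone_rotate_cm i : 'M[k]_(adim (cob (shift X) i),
    adim (cob (cone (cone_in f)) i)) :=
  row_mx 0 (row_mx 1%:M 0 : 'M_(_, adim (cob X (i + 1)) + adim (cob Y i))).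

Lemma mul_cone_rotate_cm m i (F : 'M_(m, _)) : F *m cone_rotate_cm i =
  row_mx (0 : 'M_(m, adim (cob Y (i + 1))))
    (row_mx F 0 : 'M_(_, adim (cob X (i + 1)) + adim (cob Y i))).
Proof.
transitivity (row_mx (F *m (0 : 'M_(_, adim (cob Y (i + 1))))) (F *m (row_mx 1%:M 0 :
    'M_(_, adim (cob X (i + 1)) + adim (cob Y i))))); first exact: mul_mx_row.
by rewrite mul_mx_row !mulmx0 mulmx1.
Qed.

Lemma cone_rotate_alinear i : alinear (cone_rotate_cm i).
Proof.
apply: (@alinear_row k A (cob Y (i + 1)) (cob (cone f) i) (cob X (i + 1))).
  exact: alinear0.
by apply: alinear_row; [exact: alinear1|exact: alinear0].
Qed.

Lemma cone_rotate_comm i : cone_rotate_cm (i + 1) *m cd (cone (cone_in f)) i =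
  cd (shift X) i *m cone_rotate_cm i.
Proof.
rewrite [RHS]mul_cone_rotate_cm /cone_rotate_cm mul_row_block !mul0mx !add0r.
rewrite mul_row_col mul0mx mul1mx addr0; congr row_mx.
by rewrite mul_row_block !mul1mx !mul0mx !addr0.
Qed.

Definition cone_rotate : cmap (cone (cone_in f)) (shift X) :=
  CMap cone_rotate_alinear cone_rotate_comm.

Lemma cone_rotate_quasi_iso : quasi_iso cone_rotate.
Proof.
split=> i.
  move=> z w; rewrite -[z](@vsubmxK _ (adim (cob Y (i + 1 + 1)))).
  rewrite -[dsubmx z](@vsubmxK _ (adim (cob X (i + 1 + 1)))).
  move: (usubmx z) (usubmx (dsubmx z)) (dsubmx (dsubmx z)) => y x y'.
  rewrite /= /cone_d /= /cone_d !mul_block_col !mul0mx !addr0 mul_col_mx.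
  rewrite mul0mx mul1mx add_col_mx add0r -!col_mx0.
  move=> /eq_col_mx[_ /eq_col_mx[_ dz]].
  rewrite /cone_rotate_cm !mul_row_col !mul0mx mul1mx addr0 add0r => xE.
  exists (col_mx (y' - cm f (i + 1) *m w) (col_mx w 0)).
  rewrite !mul_block_col mul_col_mx !mul0mx mul1mx mulmx0 !addr0 add_col_mx.
  rewrite add0r -xE subrK; congr col_mx.
  have -> : y = - (cm f (i + 1 + 1) *m x + cd Y (i + 1) *m y').
    by apply/eqP; rewrite -addr_eq0 dz.
  by rewrite xE !(mulmxBr, mulNmx, mulmxN) !mulmxA cm_comm; mx_abel.
move=> /= x /eqP; rewrite mulNmx oppr_eq0 => /eqP dx.
have ndx : - cd X (i + 1 + 1) *m x = 0 by rewrite mulNmx dx oppr0.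
exists (col_mx (- (cm f (i + 1 + 1) *m x)) (col_mx x 0)), 0.
rewrite /cone_d /= /cone_d !mul_block_col !mul0mx !addr0 mul_col_mx mulmx0 addr0.
rewrite mul0mx mul1mx add_col_mx add0r ndx addNr col_mx0 mulNmx mulmxN opprK.
rewrite mulmxA -cm_comm -mulmxA dx mulmx0 col_mx0 mulmx0 addr0; split=> //.
by rewrite /cone_rotate_cm !mul_row_col !mul0mx mul1mx !addr0 add0r.
Qed.

(** The homotopy is the projection onto the last summand Y. This is the source of the minus sign in
    a rotated triangle. *)
Lemma cone_out_rotate :
  homotopic (cone_out (cone_in f)) (ccomp (- cshift f) cone_rotate).
Proof.
exists (fun i => row_mx 0 (row_mx 0 1%:M :
  'M_(_, adim (cob X (i + 1 + 1)) + adim (cob Y (i + 1))))).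
split=> i.
  apply: (@alinear_row k A (cob Y (i + 1 + 1)) (cob (cone f) (i + 1))
    (cob Y (i + 1))).
    exact: alinear0.
  by apply: alinear_row; [exact: alinear0|exact: alinear1].
rewrite cmD cmN /= /cone_d /= /cone_d /cone_rotate_cm.
rewrite mul_row_block !mul0mx !add0r !mul_mx_row !mulmx0 mul_row_col mul0mx.
rewrite mul_row_block !mul0mx !mul1mx !add0r !mulmx1.
rewrite !(opp_row_mx, add_row_mx, oppr0, addr0, add0r, opprK).
by rewrite addNr.
Qed.

End Rotation.

(** * Triangles *)

Section Triangles.
Variables (k : closedFieldType) (A : falgType k).
Hypothesis hA : hereditary A.
Implicit Types X Y Z W : cplx A.

Lemma resolve X : exists P (p : cmap P X) (p' : Hom X P),
  [/\ projective_cplx P, quasi_iso p, hcomp (Q p) p' = hid X &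
      hcomp p' (Q p) = hid P].
Proof.
have [P [p [pP hp]]] := projective_resolution X hA.
exists P, p, (hclass (winv hp)); split=> //; [exact: Q_invr|exact: Q_invl].
Qed.

Lemma cone_exact_cov X Y Z (f : cmap X Y) (h : Hom Z Y) :
  hcomp (Q (cone_in f)) h = 0 -> exists h', h = hcomp (Q f) h'.
Proof.
have [P [p [p' [pP _ pp' _]]]] := resolve Z => fh.
have [g gE] := Q_surj pP (hcomp h (Q p)).
have /(Q_eq0 pP)/cone_lift[g' /Q_homotopic gg'] :
    Q (ccomp (cone_in f) g) = 0 by rewrite Q_comp -gE hcompA fh hcomp0l.
exists (hcomp (Q g') p'); rewrite hcompA -Q_comp -gg' -gE.
by rewrite -hcompA pp' hcomp_idr.
Qed.

Lemma cone_comp0 X Y (f : cmap X Y) : hcomp (Q (cone_in f)) (Q f) = 0.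
Proof.
rewrite -Q_comp; apply: Q_nullhomotopic.
exists (fun i => col_mx 1%:M 0); split=> i.
  by apply: alinear_col; [exact: alinear1|exact: alinear0].
rewrite /= /cone_d mul_block_col !mul0mx mulmx0 !mulmx1 !mul_col_mx.
by rewrite add_col_mx !mul0mx mul1mx !addr0 mul1mx addNr.
Qed.

(** Here both ends need resolving: f lifts to f' between projective complexes, a descends along the
    cone of f', and that cone is compared with the cone of f by [homotopic_cone_map]. *)
Lemma cone_exact_contra X Y Z (f : cmap X Y) (a : Hom Y Z) :
  hcomp a (Q f) = 0 -> exists a', a = hcomp a' (Q (cone_in f)).
Proof.
have [P [q [q' [pP hq _ _]]]] := resolve X.
have [R [r [r' [pR hr rr' _]]]] := resolve Y => af.
have [f' ff'] := quasi_iso_lift pP hr (ccomp f q).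
have [phi [hphi phiE]] := homotopic_cone_map (homotopic_sym ff') hq hr.
have [g gE] := Q_surj pR (hcomp a (Q r)).
have /(Q_eq0 pP)/cone_descend[g' g'E] : Q (ccomp g f') = 0.
  rewrite Q_comp -gE -hcompA -Q_comp -(Q_homotopic ff') Q_comp hcompA af.
  exact: hcomp0l.
exists (hcomp (Q g') (hclass (winv hphi))).
rewrite -[LHS]hcomp_idr -rr' hcompA gE -g'E Q_comp.
rewrite -[Q (cone_in f')]hcomp_idl -(Q_invl hphi) -(hcompA _ (Q phi)) -Q_comp phiE.
by rewrite Q_comp -!hcompA rr' hcomp_idr.
Qed.

Lemma hshift_comp X Y Z (g : Hom Y Z) (f : Hom X Y) :
  hshift (hcomp g f) = hcomp (hshift g) (hshift f).
Proof.
have [u ->] := hclass_surj f; have [v ->] := hclass_surj g.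
by rewrite !(hcompE, hshiftE).
Qed.

Lemma hshift_Q X Y (f : cmap X Y) : hshift (Q f) = Q (cshift f).
Proof. exact: hshiftE. Qed.

Lemma hshift_id X : hshift (hid X) = hid (shift X).
Proof. by rewrite [hid X]/(Q _) hshift_Q; congr (Q _); apply: cmap_ext. Qed.

Lemma hshift_zmod_morphism X Y :
  zmod_morphism (@hshift k A X Y : Hom X Y -> Hom (shift X) (shift Y)).
Proof.
move=> f g; apply/eqP; rewrite eq_sym subr_eq; apply/eqP.
rewrite -{1}[f](subrK g); move: (f - g) => h.
have [u ->] := hclass_surj h; have [v ->] := hclass_surj g.
by rewrite -[_ + _]/(hadd _ _) -[RHS]/(hadd _ _) !(haddE, hshiftE).
Qed.

HB.instance Definition _ X Y := GRing.isZmodMorphism.Build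
  (Hom X Y) (Hom (shift X) (shift Y)) (@hshift k A X Y) (@hshift_zmod_morphism X Y).

Lemma hshift0 X Y : hshift (0 : Hom X Y) = 0.
Proof. exact: raddf0. Qed.
Lemma hshiftD X Y (f g : Hom X Y) : hshift (f + g) = hshift f + hshift g.
Proof. exact: raddfD. Qed.
Lemma hshiftN X Y (f : Hom X Y) : hshift (- f) = - hshift f.
Proof. exact: raddfN. Qed.

Lemma hshift_iso X Y (f : hom (X : Db A) Y) : is_iso f -> is_iso (hshift f).
Proof.
case=> g [gf fg]; exists (hshift g).
split; rewrite -[LHS]hshift_comp.
  by rewrite [hcomp g f]gf [hshift _]hshift_id.
by rewrite [hcomp f g]fg [hshift _]hshift_id.
Qed.

Lemma unshift_cmap X Y (g : cmap (shift X) (shift Y)) :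
  exists f : cmap X Y, cshift f = g.
Proof.
have [c cE] := @reindex (fun i => 'M[k]_(adim (cob Y i), adim (cob X i))) (cm g).
have lc : forall i, @alinear k A (cob X i) (cob Y i) (c i).
  by apply: succ_int_ind => i; rewrite cE; apply: (cm_linear g).
have dc : forall i, c (i + 1) *m cd X i = cd Y i *m c i.
  apply: succ_int_ind => i; rewrite !cE; apply: oppr_inj.
  by rewrite -mulmxN -mulNmx; apply: (cm_comm g).
by exists (CMap lc dc); apply: cmap_ext => i /=.
Qed.

Lemma hshift_surj X Y (f : Hom (shift X) (shift Y)) : exists g, f = hshift g.
Proof.
have [P [p [p' [pP _ pp' _]]]] := resolve X.
have [|h hE] := @Q_surj k A (shift P) _ _ (hcomp f (Q (cshift p))).
  by move=> i; apply: pP.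
have [g gE] := unshift_cmap h; exists (hcomp (Q g) p').
rewrite hshift_comp hshift_Q gE -hE -hcompA -hshift_Q -hshift_comp pp' hshift_id.
by rewrite hcomp_idr.
Qed.

Lemma nullhomotopic_unshift X Y (f : cmap X Y) :
  nullhomotopic (cshift f) -> nullhomotopic f.
Proof.
case=> h [lh hh].
have [c cE] := @reindex (fun i => 'M[k]_(adim (cob Y i), adim (cob X (i + 1)))) h.
exists (fun i => - c i); split; apply: succ_int_ind => i; rewrite !cE.
  exact/alinearN/lh.
by have /= -> := hh i; rewrite !(mulmxN, mulNmx).
Qed.

Lemma hshift_eq0 X Y (f : Hom X Y) : hshift f = 0 -> f = 0.
Proof.
have [P [p [p' [pP _ pp' _]]]] := resolve X => f0.
have [g gE] := Q_surj pP (hcomp f (Q p)).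
have /(@Q_eq0 k A (shift P))/nullhomotopic_unshift/Q_nullhomotopic g0 :
    Q (cshift g) = 0.
  by rewrite -hshift_Q -gE hshift_comp f0 hcomp0l.
rewrite -[f]hcomp_idr -pp' hcompA gE g0 ?hcomp0l // => i; exact: pP.
Qed.

Lemma hshift_inj X Y : injective (@hshift k A X Y : Hom X Y -> Hom _ _).
Proof.
move=> f g fg; apply/eqP; rewrite -subr_eq0; apply/eqP/hshift_eq0.
by rewrite raddfB /= fg subrr.
Qed.

Lemma cone_distinguished X Y (f : cmap X Y) :
  distinguished (Q f) (Q (cone_in f)) (Q (cone_out f)).
Proof.
have iso1 Z : is_iso (hid Z : hom (Z : Db A) Z).
  by exists (hid Z); split; apply: hcomp_idl.
exists X, Y, f, (hid X), (hid Y), (hid (cone f)); split=> //.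
by rewrite hshift_id; split; rewrite [LHS]hcomp_idl [RHS]hcomp_idr.
Qed.

Section Distinguished.
Variables (X Y Z : Db A) (u : hom X Y) (v : hom Y Z) (w : hom Z (shift X : Db A)).
Hypothesis uvw : distinguished u v w.

Lemma distinguished_rotate :
  distinguished v w (- (hshift u : Hom _ _) : hom (shift X : Db A) (shift Y)).
Proof.
have [X' [Y' [f [a [b [c [[ia ib ic] [bf cv aw]]]]]]]] := uvw.
exists Y', (cone f), (cone_in f), b, c, (hcomp (hshift a) (Q (cone_rotate f))).
split; first split=> //.
  have [a' [a'a aa']] := hshift_iso ia.
  have [r [rQ Qr]] := Q_is_iso (cone_rotate_quasi_iso f).
  exists (hcomp r a'); split; rewrite [LHS]hcompA.
    by rewrite -(hcompA r) [hcomp a' _]a'a hcomp_idr; apply: rQ.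
  by rewrite -(hcompA _ (Q _)) [hcomp (Q _) _]Qr hcomp_idr; apply: aa'.
split=> //.
  rewrite -[LHS]/(hcomp _ _) -hcompA -Q_comp.
  have -> : ccomp (cone_rotate f) (cone_in (cone_in f)) = cone_out f.
    apply: cmap_ext => i /=; rewrite /cone_rotate_cm mul_row_col mul0mx add0r.
    by rewrite mulmx1.
  exact: aw.
rewrite (Q_homotopic (cone_out_rotate f)) -[LHS]/(hcomp _ _) Q_comp.
have -> : Q (- cshift f) = - hshift (Q f) by rewrite hshift_Q; apply: raddfN.
rewrite -[RHS]/(hcomp _ _) !hcompA; congr (hcomp _ _).
by rewrite hcompNr hcompNl -!hshift_comp; congr (- hshift _); apply: bf.
Qed.

Lemma distinguished_comp0 : hcomp v u = 0.
Proof.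
have [X' [Y' [f [a [b [c [[[a' [_ aa']] ib ic] [bf cv aw]]]]]]]] := uvw.
have <- : hcomp (hcomp v u) (hcomp a a') = hcomp v u.
  by rewrite [hcomp a a']aa' hcomp_idr.
rewrite -(hcompA v) (hcompA u) -[hcomp u a]bf -(hcompA b) (hcompA v) -[hcomp v b]cv.
by rewrite -(hcompA c) (hcompA (Q (cone_in f))) cone_comp0 hcomp0l hcomp0r.
Qed.

Lemma distinguished_exact_cov W (h : Hom W Y) :
  hcomp v h = 0 -> exists h', h = hcomp u h'.
Proof.
have [X' [Y' [f [a [b [c [[ia [b' [_ bb']] [c' [c'c _]]] [bf cv aw]]]]]]]] := uvw => vh.
have [|h' hE] := @cone_exact_cov X' Y' W f (hcomp b' h).
  have -> : Q (cone_in f) = hcomp c' (hcomp v b).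
    by rewrite -[hcomp v b]cv [RHS]hcompA [hcomp c' c]c'c hcomp_idl.
  by rewrite -!hcompA (hcompA b) [hcomp b b']bb' hcomp_idl vh hcomp0r.
exists (hcomp a h'); rewrite hcompA -[hcomp u a]bf -[hcomp (hcomp b _) _]hcompA -hE.
by rewrite hcompA [hcomp b b']bb' hcomp_idl.
Qed.

Lemma distinguished_exact_contra W (h : Hom Y W) :
  hcomp h u = 0 -> exists h', h = hcomp h' v.
Proof.
have [X' [Y' [f [a [b [c [[ia [b' [_ bb']] [c' [c'c _]]] [bf cv aw]]]]]]]] := uvw => hu.
have [|h' hE] := @cone_exact_contra X' Y' W f (hcomp h b).
  by rewrite -hcompA [hcomp b _]bf hcompA hu hcomp0l.
have inE : Q (cone_in f) = hcomp c' (hcomp v b).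
  by rewrite -[hcomp v b]cv [RHS]hcompA [hcomp c' c]c'c hcomp_idl.
exists (hcomp h' c'); rewrite -[LHS]hcomp_idr -[hid _]bb' [hcomp h _]hcompA hE inE.
by rewrite -!hcompA [hcomp b b']bb' hcomp_idr.
Qed.

End Distinguished.
End Triangles.

(** * Finiteness of endomorphism rings *)

(** S need not be a subspace: among finite families from S take one of maximal rank, so that
    adjoining another element of S cannot enlarge the span. *)
Lemma finite_spanning_rows (k : fieldType) q (S : 'rV[k]_q -> Prop) :
  exists p (B : 'M[k]_(p, q)), (forall l, S (row l B)) /\
    forall v, S v -> exists D : 'rV_p, v = D *m B.
Proof.
pose has_rank r := `[< exists p (B : 'M[k]_(p, q)),
  (forall l, S (row l B)) /\ \rank B = r >].
have has0 : exists r, has_rank r.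
  by exists 0%N; apply/asboolP; exists 0%N, 0; split=> [[]|] //; rewrite mxrank0.
have has_le r : has_rank r -> (r <= q)%N.
  by case/asboolP => p [B [_ <-]]; apply: rank_leq_col.
case: (ex_maxnP has0 has_le) => r /asboolP[p [B [SB rB]]] max_r.
exists p, B; split=> // v Sv; apply/submxP.
have sB : (B <= col_mx v B)%MS by rewrite -addsmxE addsmxSr.
have [_] := mxrank_leqif_sup sB; rewrite col_mx_sub submx_refl andbT => <-.
rewrite eqn_leq mxrankS // rB; apply/max_r/asboolP.
exists (1 + p)%N, (col_mx v B); split=> // l.
case: (split_ordP l) => j ->; last by rewrite rowKd.
by rewrite rowKu (_ : row j v = v) //; apply/rowP => i; rewrite mxE (ord1 j).
Qed.

Section FiniteEndo.
Variables (k : closedFieldType) (A : falgType k).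

Section Scalar.
Variables (X : cplx A) (a : k).

Lemma cscal_alinear i : @alinear k A (cob X i) (cob X i) a%:M.
Proof. by move=> b; rewrite scalar_mxC. Qed.
Lemma cscal_comm i : a%:M *m cd X i = cd X i *m a%:M.
Proof. by rewrite scalar_mxC. Qed.
(** [Hom] carries no k-structure, so the scalars of k act through these central chain maps. *)
Definition cscal : cmap X X := CMap cscal_alinear cscal_comm.

End Scalar.

Lemma cscalC X Y a (f : cmap X Y) : ccomp f (cscal X a) = ccomp (cscal Y a) f.
Proof. by apply: cmap_ext => i /=; rewrite scalar_mxC. Qed.

Lemma cm_sum (X Y : cplx A) I (r : seq I) (F : I -> cmap X Y) i :
  cm (\sum_(l <- r) F l) i = \sum_(l <- r) cm (F l) i.
Proof. exact: (big_morph (fun f : cmap X Y => cm f i)). Qed.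

Lemma cmap_finite_span (X Y : cplx A) : exists p (c : 'I_p -> cmap X Y),
  forall f, exists D : 'I_p -> k, f = \sum_l ccomp (c l) (cscal X (D l)).
Proof.
(* Degrees -N to N contain all nonzero components, so a chain map is a vector in a finite
   dimensional space. *)
have [N bX] := cbounded X; pose deg (j : 'I_(N + N).+1) : int := j%:Z - N%:Z.
pose coords (f : cmap X Y) := \mxrow_j mxvec (cm f (deg j)).
have [p [B [SB BS]]] := finite_spanning_rows (fun v => exists f, v = coords f).
have [c cE] := boolp.choice SB.
exists p, c => f; have [|D DE] := BS (coords f); first by exists f.
exists (D 0); apply: cmap_ext => i; rewrite cm_sum.
have [le_i|lt_i] := leqP `|i| N; last by apply: flat_cols; apply: bX.
have lt_j : (`|(i + N%:Z)%R| < (N + N).+1)%N by lia.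
have [j ->] : exists j, i = deg j by exists (Ordinal lt_j); rewrite /deg /=; lia.
have := congr1 (fun M => submxrow M j) DE.
rewrite mulmx_sum_row {1}/coords mxrowK => fE.
apply: (can_inj mxvecK); rewrite fE linear_sum /=.
have subD (I : finType) (F : I -> 'M_(_, _)) : submxrow (\sum_l F l) j =
    \sum_l submxrow (F l) j.
  apply/matrixP => x y; rewrite summxE mxE summxE.
  by apply: eq_bigr => l _; rewrite mxE.
rewrite subD; apply: eq_bigr => l _; rewrite cE.
rewrite mul_mx_scalar linearZ /= -(mxrowK (fun j => mxvec (cm (c l) (deg j)))).
by apply/matrixP => x y; rewrite !mxE.
Qed.

Hypothesis hA : hereditary A.
Variable T : Db A.

Let s (a : k) : endo T := Q (cscal T a).

Let sD a b : s (a + b) = s a + s b.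
Proof.
rewrite /s -[RHS]Q_add; congr (Q _).
by apply: cmap_ext => i; apply: raddfD.
Qed.

Let s0 : s 0 = 0.
Proof. by apply: (addrI (s 0)); rewrite -sD !addr0. Qed.

Let sM a b : s (a * b) = s a * s b.
Proof.
rewrite /s -[RHS]/(hcomp _ _) -Q_comp; congr (Q _).
by apply: cmap_ext => i; rewrite /= -scalar_mxM mulrC.
Qed.

Let s_sum I r (F : I -> k) : s (\sum_(i <- r) F i) = \sum_(i <- r) s (F i).
Proof. exact: (big_morph s sD s0). Qed.

(** On a projective resolution P every endomorphism comes from a chain map, and chain maps P -> P
    are finitely spanned; the spanning family is conjugated back to T. *)
Lemma endo_finite_span : exists p (g : 'I_p -> endo T),
  forall f : endo T, exists D : 'I_p -> k, f = \sum_l s (D l) * g l.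
Proof.
have [P [q [q' [pP _ qq' q'q]]]] := resolve hA T.
have [p [c cE]] := cmap_finite_span P P.
exists p, (fun l => hcomp (Q q) (hcomp (Q (c l)) q')) => f.
have [g gE] := Q_surj pP (hcomp q' (hcomp f (Q q))).
have [D DE] := cE g; exists D.
have -> : f = hcomp (Q q) (hcomp (Q g) q').
  by rewrite -gE -!hcompA qq' hcomp_idr hcompA qq' hcomp_idl.
rewrite DE (raddf_sum (@Q k A P P)) /=.
rewrite hcomp_suml hcomp_sumr.
apply: eq_bigr => l _; rewrite -[RHS]/(hcomp _ _) -!hcompA.
congr (hcomp _ _); rewrite Q_comp -hcompA; congr (hcomp _ _).
rewrite -[Q (cscal P _)]hcomp_idl -q'q -(hcompA q') -Q_comp cscalC Q_comp.
by rewrite -!hcompA qq' hcomp_idr.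
Qed.

(** The relations between the e i, written in k-coordinates over a finite spanning family of End(T),
    are spanned by finitely many of them over k, hence over End(T). *)
Lemma endo_noetherian (M : lmodType (endo T)) n (e : 'I_n -> M) :
  exists p (c : 'I_p -> 'I_n -> endo T),
    (forall l, \sum_i c l i *: e i = 0) /\
    forall x : 'I_n -> endo T, \sum_i x i *: e i = 0 ->
      exists t : 'I_p -> endo T, forall i, x i = \sum_l t l * c l i.
Proof.
have [p [g gE]] := endo_finite_span.
pose x (v : 'rV[k]_(n * p)) i : endo T := \sum_l s (vec_mx v i l) * g l.
have [r [B [SB BS]]] := finite_spanning_rows (fun v => \sum_i x v i *: e i = 0).
exists r, (fun l => x (row l B)); split=> // y ye.
have [D DE] := boolp.choice (fun i => gE (y i)).
have xE i : y i = x (mxvec (\matrix_(i, l) D i l)) i.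
  by rewrite DE /x mxvecK; apply: eq_bigr => l _; rewrite mxE.
have [|F FE] := BS (mxvec (\matrix_(i, l) D i l)).
  by rewrite -[RHS]ye; apply: eq_bigr => i _; rewrite xE.
exists (fun l => s (F 0 l)) => i; rewrite xE FE mulmx_sum_row /x linear_sum.
under eq_bigr => b _.
  rewrite summxE s_sum mulr_suml.
  over.
rewrite exchange_big; apply: eq_bigr => l _; rewrite mulr_sumr.
by apply: eq_bigr => b _; rewrite linearZ mxE sM mulrA.
Qed.

End FiniteEndo.

(** * The functor Hom(T, -) on W *)

Lemma full_faithful_dense_equivalence (C D : category) (F : functor C D) :
  full F ->
  (forall X Y (f g : hom X Y), fmap F f = fmap F g -> f = g) ->
  dense F -> is_equivalence F.
Proof.
move=> fullF faithF denseF.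
pose pre X Y (g : hom (F X) (F Y)) := sval (boolp.cid (fullF X Y g)).
have preK X Y (g : hom (F X) (F Y)) : fmap F (pre X Y g) = g.
  by rewrite /pre; case: boolp.cid.
pose obj Y := sval (boolp.cid (denseF Y)).
pose to Y : hom (F (obj Y)) Y := sval (boolp.cid (svalP (boolp.cid (denseF Y)))).
have to_iso Y : is_iso (to Y) := svalP (boolp.cid (svalP (boolp.cid (denseF Y)))).
pose from Y : hom Y (F (obj Y)) := sval (boolp.cid (to_iso Y)).
have [fromK toK] :
    (forall Y, from Y ∘ to Y = idm _) /\ (forall Y, to Y ∘ from Y = idm _).
  by split=> Y; rewrite /from; case: boolp.cid => ? [].
pose Hmap Y Y' (g : hom Y Y') := pre _ _ (from Y' ∘ g ∘ to Y).
have Hid Y : Hmap _ _ (idm Y) = idm (obj Y).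
  by apply: faithF; rewrite preK fmap_id comp_idr fromK.
have Hcomp Y Y' Y'' (g : hom Y' Y'') (f : hom Y Y') :
    Hmap _ _ (g ∘ f) = Hmap _ _ g ∘ Hmap _ _ f.
  apply: faithF; rewrite fmap_comp !preK !compA.
  by rewrite -(compA _ (to Y') (from Y')) toK comp_idr.
exists (Functor Hid Hcomp); split.
  exists (fun X => pre _ _ (to (F X))); split=> [X|X Y f] /=.
    exists (pre _ _ (from (F X))).
    by split; apply: faithF; rewrite fmap_comp !preK fmap_id ?fromK ?toK.
  by apply: faithF; rewrite !fmap_comp !preK !compA toK comp_idl.
exists to; split=> [Y|Y Y' g] /=; first exact: to_iso.
by rewrite preK !compA toK comp_idl.
Qed.

(** The value at x is phi of a chosen preimage; the kernel condition makes it independent of the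
    choice. *)
Lemma linear_factor (R : pzRingType) (P M N : lmodType R)
    (u : {linear P -> M}) (phi : {linear P -> N}) :
  (forall x, exists h, u h = x) -> (forall h, u h = 0 -> phi h = 0) ->
  exists f : {linear M -> N}, forall h, f (u h) = phi h.
Proof.
move=> usurj uphi; have [s sK] := boolp.choice usurj.
have phis h : phi (s (u h)) = phi h.
  by apply/eqP; rewrite -subr_eq0 -linearB uphi // linearB sK subrr.
have lin : linear (phi \o s).
  by move=> a x y; rewrite /= -linearP -[in RHS]phis linearP !sK.
pose f : {linear M -> N} := HB.pack (phi \o s) (GRing.isLinear.Build R M N *:%R _ lin).
by exists f => h; apply: phis.
Qed.

Lemma linear_same_kernel_iso (R : pzRingType) (P M N : lmodType R)
    (u : {linear P -> M}) (phi : {linear P -> N}) :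
  (forall x, exists h, u h = x) -> (forall y, exists h, phi h = y) ->
  (forall h, u h = 0 <-> phi h = 0) ->
  exists (f : {linear M -> N}) (g : {linear N -> M}), cancel f g /\ cancel g f.
Proof.
move=> usurj phisurj uphi.
have [f fE] := linear_factor usurj (fun h => proj1 (uphi h)).
have [g gE] := linear_factor phisurj (fun h => proj2 (uphi h)).
exists f, g; split=> x.
  by have [h <-] := usurj x; rewrite fE gE.
by have [h <-] := phisurj x; rewrite gE fE.
Qed.

(** * Objects of [W] and presentations by add T *)

Section PresentedObjects.
Variables (k : closedFieldType) (A : falgType k).
Hypothesis hA : hereditary A.
Variable T : Db A.
Hypothesis ext1 : forall f : Hom T (shift T), f = 0.
Implicit Types (X Y Z V : Db A).

Lemma add_closure_hid U V : add_closure U V -> sum_through U (hid V).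
Proof.
move=> UV; apply/factors_sum_through; exists V, (hid V), (hid V); split=> //.
by rewrite -[RHS]/(hcomp _ _) hcomp_idl.
Qed.

Lemma sum_through_family U X Y (f : Hom X Y) : sum_through U f ->
  exists n (a : 'I_n -> Hom X U) (b : 'I_n -> Hom U Y),
    f = \sum_i hcomp (b i) (a i).
Proof.
elim=> [|a b g _ [n [a' [b' ->]]]].
  by exists 0%N, (fun=> 0), (fun=> 0); rewrite big_ord0.
exists n.+1, (fun i => oapp a' a (unlift ord0 i)), (fun i => oapp b' b (unlift ord0 i)).
rewrite big_ord_recl unlift_none; congr (_ + _).
by apply: eq_bigr => i _; rewrite liftK.
Qed.

(** Maps from T detect zero on add T: with f an identity, g vanishes as soon as it kills every map
    from T. *)
Lemma sum_through_test X Y Z (f : Hom X Y) (g : Hom Y Z) : sum_through T f ->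
  (forall t : Hom T Y, hcomp g t = 0) -> hcomp g f = 0.
Proof.
move=> Tf gt; elim: Tf => [|a b h _ IH]; first by rewrite hcomp0r.
by rewrite hcompDr IH hcompA gt hcomp0l addr0.
Qed.

Lemma sum_through_hshift X Y (f : Hom X Y) (t : Hom T (shift X)) :
  sum_through T f -> hcomp (hshift f) t = 0.
Proof.
elim=> [|a b h _ IH]; first by rewrite hshift0 hcomp0l.
by rewrite hshiftD hcompDl IH hshift_comp -hcompA [hcomp _ t]ext1 hcomp0r addr0.
Qed.

Lemma add_closure_ext1 V (t : Hom T (shift V)) : add_closure T V -> t = 0.
Proof.
move/add_closure_hid/(sum_through_hshift t) => <-.
by rewrite hshift_id hcomp_idl.
Qed.

Lemma sum_through_shift U X Y (f : Hom X Y) : sum_through U f ->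
  sum_through (shift U) (hshift f).
Proof.
elim=> [|a b h _ IH]; first by rewrite hshift0; constructor.
by rewrite hshiftD hshift_comp; constructor.
Qed.

Lemma sum_through_shift_test X Y (f : Hom X Y) (t : Hom T X) :
  sum_through (shift T : Db A) f -> hcomp f t = 0.
Proof.
elim=> [|a b h _ IH]; first by rewrite hcomp0l.
by rewrite hcompDl IH -hcompA [hcomp _ t]ext1 hcomp0r addr0.
Qed.

(** The connecting map Z[1] -> X[1] is the shift of some d because the shift is full. Rotating twice
    and unshifting makes u a weak cokernel of d. *)
Lemma in_W_presentation M : in_W T M ->
  exists (Z X : Db A) (d : Hom Z X) (u : Hom X M) (v : Hom M (shift Z)),
    [/\ add_closure T Z, add_closure T X, distinguished u v (hshift d : hom _ _),
       hcomp u d = 0 & forall M' (a : Hom X M'), hcomp a d = 0 ->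
         exists b, a = hcomp b u].
Proof.
case=> X [Y [u [v [w [TX [Z TZ YE] uvw]]]]]; subst Y.
have [d wd] := hshift_surj hA w; subst w; exists Z, X, d, u, v.
have rot := distinguished_rotate (distinguished_rotate uvw).
split=> // [|M' a ad].
  apply: (hshift_inj hA); rewrite hshift0 hshift_comp.
  by have := distinguished_comp0 rot; rewrite hcompNl => /eqP; rewrite oppr_eq0 => /eqP.
have [|b' b'E] := distinguished_exact_contra hA rot (h := hshift a).
  by rewrite -hshift_comp ad hshift0.
have [b bE] := hshift_surj hA b'; exists (- b); apply: (hshift_inj hA).
by rewrite b'E hshift_comp hshiftN hcompNl hcompNr bE.
Qed.

Lemma presentation_surj Z X M (u : hom X M) (v : hom M (shift Z : Db A))
    (w : hom (shift Z : Db A) (shift X)) (h : Hom T M) :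
  add_closure T Z -> distinguished u v w ->
  exists h', h = hcomp u h'.
Proof.
move=> TZ uvw; apply: (distinguished_exact_cov hA uvw).
exact: add_closure_ext1.
Qed.

Lemma in_W_finitely_generated M :
  in_W T M -> finitely_generated (hom_functor T M).
Proof.
case/in_W_presentation => Z [X [d [u [v [TZ TX uvw _ _]]]]].
have [n [a [b abE]]] := sum_through_family (add_closure_hid TX).
exists n, (fun i => hcomp u (b i)) => h.
have [h' ->] := presentation_surj h TZ uvw.
exists (fun i => hcomp (a i) h').
rewrite -[h' in LHS]hcomp_idl abE hcomp_suml hcomp_sumr.
by apply: eq_bigr => i _; rewrite -[RHS]/(hcomp _ _) -!hcompA.
Qed.

Lemma in_W_full M M' (g : {linear Hom T M -> Hom T M'}) : in_W T M ->
  exists f : Hom M M', forall t, g t = hcomp f t.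
Proof.
case/in_W_presentation => Z [X [d [u [v [TZ TX uvw ud ex]]]]].
have [n [a [b abE]]] := sum_through_family (add_closure_hid TX).
(* Linearity determines g on maps from T alone; splitting the identity of X through T turns it into
   a morphism out of X. *)
pose g' : Hom X M' := \sum_i hcomp (g (hcomp u (b i))) (a i).
have g'E t : hcomp g' t = g (hcomp u t).
  rewrite -[t in RHS]hcomp_idl abE hcomp_suml hcomp_sumr linear_sum hcomp_suml.
  apply: eq_bigr => i _; rewrite -hcompA.
  rewrite -[LHS]/((hcomp (a i) t : endo T) *: g (hcomp u (b i))) -linearZ.
  congr (g _); rewrite -[LHS]/(hcomp (hcomp u (b i)) (hcomp (a i) t)).
  by rewrite !hcompA.
have [|f fE] := ex _ g'.
  rewrite -[hcomp _ _]hcomp_idr; apply: sum_through_test (add_closure_hid TZ) _.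
  by move=> t; rewrite -hcompA g'E hcompA ud hcomp0l linear0.
exists f => t; have [t' ->] := presentation_surj t TZ uvw.
by rewrite -g'E fE hcompA.
Qed.

(** Such an f kills X, hence factors through v : M -> Z[1], and Z[1] lies in add(T[1]). *)
Lemma in_W_faithful M M' (f : Hom M M') : in_W T M ->
  (forall t : Hom T M, hcomp f t = 0) -> factors_through_add (shift T) f.
Proof.
case/in_W_presentation => Z [X [d [u [v [TZ TX uvw _ _]]]]] ft.
have [|f' ->] := distinguished_exact_contra hA uvw (h := f).
  rewrite -[hcomp _ _]hcomp_idr; apply: sum_through_test (add_closure_hid TX) _.
  by move=> t; rewrite -hcompA ft.
apply/factors_sum_through; rewrite -[v]hcomp_idl -hshift_id.
exact/sum_through_comp/sum_through_shift/add_closure_hid.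
Qed.

Lemma power_biproduct n : exists (i : 'I_n -> Hom T (power n T))
    (p : 'I_n -> Hom (power n T) T),
  (forall j l, hcomp (p j) (i l) = hid T *+ (j == l)) /\
  \sum_j hcomp (i j) (p j) = hid (power n T).
Proof.
elim: n => [|n [i [p [pi ip]]]].
  by exists (fun=> 0), (fun=> 0); split=> [[]|] //; rewrite big_ord0 hid0.
pose inl := Q (sum_inl T (power n T)) : Hom _ (power n.+1 T).
pose inr := Q (sum_inr T (power n T)) : Hom _ (power n.+1 T).
pose fst := Q (sum_fst T (power n T)) : Hom (power n.+1 T) _.
pose snd := Q (sum_snd T (power n T)) : Hom (power n.+1 T) _.
exists (fun j => oapp (fun j => hcomp inr (i j)) inl (unlift ord0 j)).
exists (fun j => oapp (fun j => hcomp (p j) snd) fst (unlift ord0 j)); split.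
  move=> j l; case: (unliftP ord0 j) => [j'|] ->; case: (unliftP ord0 l) => [l'|] -> /=.
  - rewrite -hcompA (hcompA snd) snd_inr hcomp_idl pi.
    by rewrite (inj_eq lift_inj).
  - by rewrite -hcompA snd_inl hcomp0r.
  - by rewrite hcompA fst_inr hcomp0l.
  - exact: fst_inl.
rewrite big_ord_recl unlift_none /= -[RHS]sum_id; congr (_ + _).
transitivity (hcomp inr (hcomp (hid (power n T)) snd)); last by rewrite hcomp_idl.
rewrite -ip hcomp_suml hcomp_sumr; apply: eq_bigr => j _.
by rewrite liftK /= -!hcompA.
Qed.

Lemma add_closure_iso n X (f : Hom X (power n T)) (g : Hom (power n T) X) :
  hcomp g f = hid X -> hcomp f g = hid (power n T) -> add_closure T X.
Proof.
move=> gf fg; exists n, (czero A : Db A), (hcomp f (Q (sum_fst _ _))).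
exists (hcomp (Q (sum_inl _ _)) g); split; rewrite [LHS]hcompA.
  rewrite -(hcompA _ g) gf hcomp_idr -[RHS]sum_id.
  by rewrite [Q (sum_inr _ _)]Q_from0 hcomp0l addr0.
by rewrite -(hcompA f) fst_inl hcomp_idr.
Qed.

(** M is the cone of f, made into a chain map by resolving T^p. Hom(T, M) is then the cokernel of
    Hom(T, f), since Hom(T, P[1]) = 0. *)
Lemma presented_in_W n p (f : Hom (power p T) (power n T)) :
  exists M (u : Hom (power n T) M),
    [/\ in_W T M, forall h : Hom T M, exists h', h = hcomp u h' &
      forall h : Hom T (power n T),
        hcomp u h = 0 <-> exists h', h = hcomp f h'].
Proof.
have [P [q [q' [pP _ qq' q'q]]]] := resolve hA (power p T).
have [g gE] := Q_surj pP (hcomp f (Q q)).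
have TP : add_closure T P by apply: add_closure_iso q'q qq'.
have dist := cone_distinguished g.
have rot := distinguished_rotate dist.
exists (cone g), (Q (cone_in g)); split=> [|h|h].
- exists (power n T), (shift P), (Q (cone_in g)), (Q (cone_out g)).
  exists (- hshift (Q g) : Hom _ _); split=> //; first exact: add_closure_power.
  by exists P.
- exact: presentation_surj TP rot.
- split=> [/(distinguished_exact_cov hA dist)[h' ->]|[h' ->]].
    by exists (hcomp (Q q) h'); rewrite hcompA -gE.
  rewrite -[f]hcomp_idr -qq' (hcompA f) gE -!hcompA.
  by rewrite (hcompA (Q (cone_in g))) cone_comp0 hcomp0l.
Qed.

Lemma in_W_dense (N : lmodType (endo T)) : finitely_generated N ->
  exists M, in_W T M /\
    exists (f : {linear Hom T M -> N}) (g : {linear N -> Hom T M}),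
      cancel f g /\ cancel g f.
Proof.
case=> n [e eN]; have [p [c [ce cP]]] := endo_noetherian hA e.
have [i [pr [pri ipr]]] := power_biproduct n.
have [j [qr [qrj jqr]]] := power_biproduct p.
(* The matrix of relations c as a morphism T^p -> T^n. *)
pose f := \sum_l \sum_a hcomp (hcomp (i a) (c l a)) (qr l).
have prf a : hcomp (pr a) f = \sum_l hcomp (c l a) (qr l).
  rewrite hcomp_sumr; apply: eq_bigr => l _; rewrite hcomp_sumr (bigD1 a) //= big1.
    by rewrite !hcompA pri eqxx hcomp_idl addr0.
  by move=> b nba; rewrite !hcompA pri eq_sym (negPf nba) !hcomp0l.
have [M [u [WM usurj uker]]] := presented_in_W f.
exists M; split=> //.
(* The surjection onto N given by the generators e, with Hom(T, T^n) in the role of the free module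
   of rank n. *)
pose phi (h : Hom T (power n T)) : N := \sum_a (hcomp (pr a) h : endo T) *: e a.
have phi_linear : linear (phi : Hom T (power n T) -> N).
  move=> a x y; rewrite /phi scaler_sumr -big_split; apply: eq_bigr => b _.
  rewrite hcompDr scalerDl; congr (_ + _); rewrite scalerA; congr (_ *: _).
  exact: hcompA.
pose phiL : {linear Hom T (power n T) -> N} :=
  HB.pack phi (GRing.isLinear.Build (endo T) (Hom T (power n T)) N *:%R phi phi_linear).
apply: (@linear_same_kernel_iso _ _ _ _ (postcomp u : {linear Hom T _ -> Hom T _}) phiL).
- by move=> x; have [h ->] := usurj x; exists h.
- move=> y; have [x ->] := eN y; exists (\sum_a hcomp (i a) (x a)).
  apply: eq_bigr => a _; congr (_ *: _); rewrite hcomp_sumr (bigD1 a) //= big1.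
    by rewrite hcompA pri eqxx hcomp_idl addr0.
  by move=> b nba; rewrite hcompA pri eq_sym (negPf nba) hcomp0l.
move=> h; rewrite -[_ = 0]/(hcomp u h = 0) uker; split=> [[h' ->]|].
  rewrite -[LHS]/(phi _) /phi.
  transitivity (\sum_l (hcomp (qr l) h' : endo T) *: \sum_a c l a *: e a).
    under [RHS]eq_bigr do rewrite scaler_sumr.
    rewrite exchange_big; apply: eq_bigr => a _.
    rewrite hcompA prf hcomp_suml scaler_suml; apply: eq_bigr => l _.
    by rewrite scalerA; congr (_ *: _); rewrite -hcompA.
  by apply: big1 => l _; rewrite ce scaler0.
(* A relation is a combination of the chosen ones; its coefficients t assemble into a map T ->
   T^p. *)
move/cP => [t tE]; exists (\sum_l hcomp (j l) (t l)).
have qrt l : hcomp (qr l) (\sum_l hcomp (j l) (t l)) = t l.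
  rewrite hcomp_sumr (bigD1 l) //= big1.
    by rewrite hcompA qrj eqxx hcomp_idl addr0.
  by move=> b nba; rewrite hcompA qrj eq_sym (negPf nba) hcomp0l.
rewrite -[LHS]hcomp_idl -ipr hcomp_suml /f exchange_big hcomp_suml.
apply: eq_bigr => a _; rewrite -hcompA tE [LHS]hcomp_sumr [RHS]hcomp_suml.
apply: eq_bigr => l _; rewrite -hcompA qrt; exact: hcompA.
Qed.

End PresentedObjects.

Theorem theorem1 (k : closedFieldType) (A : falgType k) (hA : hereditary A)
    (m : nat) (hm : (1 <= m)%N) (T : Db A) (hT : silting T) (hTm : in_S m T) :
  exists hfg : forall X : Db A, in_W T X -> finitely_generated (hom_functor T X),
    let G : functor (W T) (mod (endo T)) := restrict_functor hfg in
    full G /\ dense G /\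
    exists hG : respects (factor_congruence (in_W T) (shift T)) G,
      is_equivalence (induced_functor hG).
Proof.
have ext1 (f : Hom T (shift T)) : f = 0 by case: hT => [[_ /(_ 1%N isT)]] + _; apply.
exists (in_W_finitely_generated hA ext1) => G.
have fullG : full G.
  move=> [X WX] [Y WY] g; have [f fE] := in_W_full hA ext1 g WX.
  by exists f; apply: linear_ext => t; rewrite fE.
have denseG : dense G.
  move=> [N fgN]; have [M [WM [f [g [gf fg]]]]] := in_W_dense hA ext1 fgN.
  exists (exist _ M WM), f, g.
  by split; apply: linear_ext => x; [apply: gf|apply: fg].
split=> //; split=> //.
(* Maps through add(T[1]) are killed because Hom(T, T[1]) = 0. *)
have hG : respects (factor_congruence (in_W T) (shift T)) G.
  move=> [X WX] [Y WY] f g /factors_sum_through fg; apply: linear_ext => t.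
  apply/eqP; rewrite -subr_eq0; apply/eqP.
  by rewrite -[LHS](hcompBl f g t); apply: (sum_through_shift_test ext1).
exists hG; apply: full_faithful_dense_equivalence.
- move=> X Y g; have [f <-] := fullG X Y g; exists (quot_class _ f).
  exact: induced_functorE.
- move=> X Y f g fg; rewrite -[f]qreprK -[g]qreprK; apply/qclassP.
  (* Two classes with the same image have representatives whose difference kills Hom(T, X), so the
     difference lies in the ideal. *)
  have fgt (t : Hom T (sval X)) :
      hcomp ((qrepr f : Hom _ _) - (qrepr g : Hom _ _) : Hom (sval X) (sval Y)) t = 0.
    rewrite hcompBl; apply/eqP; rewrite subr_eq0; apply/eqP.
    exact: (congr1 (fun h : {linear Hom T (sval X) -> Hom T (sval Y)} => h t) fg).
  exact: (in_W_faithful hA (svalP X) fgt).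
- by move=> N; have [X iX] := denseG N; exists X.
Qed.
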